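(* There exists an absolute constant $C>0$ (independent of $\sigma,\rho>0$ and of the solution) such that the following holds. Let $(E,\psi,W,\gamma,\lambda)$ be a solution of the bubble ring problem \begin{align*} -\nabla\cdot\left(\tfrac1r\nabla\psi\right)&=0 &&\text{in }\mathbb{R}^2_+\setminus\overline E,\\ \psi-\tfrac W2 r^2&=\gamma &&\text{on }\partial E,\\ 2\sigma H-\rho\left(\tfrac1r\partial_n\psi-W\,n\cdot e_r\right)^2+\lambda&=0 &&\text{on }\partial E,\\ \psi&=0 &&\text{on }\partial\mathbb{R}^2_+,\\ \psi&\to0 &&\text{as }|(r,z)|\to\infty, \end{align*} where the cross-section $E\subset\mathbb{R}^2_+$ is convex and symmetric under $z\mapsto -z$. Suppose that $\Psi:=\psi-\tfrac W2r^2$ satisfies $\partial_n\Psi\le 0$ on $\partial E$ and that $$2\pi R^2\le |E|.$$ Then $$\mathrm{We}\ \ge\ C(1+\delta).$$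
   Context: $\mathbb{R}^2_+=\{(r,z): r>0,\ z\in\mathbb{R}\}$, $\nabla=(\partial_r,\partial_z)^T$, $\nabla\cdot F=\partial_rF_r+\partial_zF_z$, and $e_r=(1,0)$. The set $E$ is the cross-section of an axisymmetric toroidal bubble: a bounded convex set with nonempty interior, with $\overline E\subset\mathbb{R}^2_+$, with $C^2$ boundary, and symmetric in the sense that $(r,z)\in E\iff(r,-z)\in E$. $n$ is the unit normal on $\partial E$ pointing into the exterior $\mathbb{R}^2_+\setminus\overline E$; $\partial_n$ is the derivative in direction $n$ taken from the exterior; $\mathrm{d}s$ is arc length; $|E|$ is the area of $E$. The quantity $H=\kappa+\frac{n\cdot e_r}{r}$ on $\partial E$ is (twice) the mean curvature of the ring, where $\kappa$ is the curvature of the planar curve $\partial E$, with the sign such that $\kappa\ge0$ for convex sets. $\sigma>0$ (surface tension) and $\rho>0$ (density) are given constants; $W,\gamma,\lambda\in\mathbb{R}$ are unknown constants that are part of the solution. Solutions $\psi:\mathbb{R}^2_+\setminus E\to\mathbb{R}$ are classical: $C^2$ in $\mathbb{R}^2_+\setminus\overline E$, $C^1$ up to $\partial E$, continuous up to $\{r=0\}$. The circulation is $\beta=-\int_{\partial E}\frac1r\partial_n\psi\,\mathrm{d}s$, the Weber number is $\mathrm{We}=\frac{\sqrt{2\pi}\,\rho\,\beta^2}{\sigma\sqrt{|E|}}$, the major radius is $R=\frac1{|E|}\int_E r\,\mathrm{d}(r,z)$, and $\delta=\int_E\frac1{r^2}\,\mathrm{d}(r,z)-2\pi$. *)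

(* Defs.v *)
From mathcomp Require Import all_boot all_order all_algebra.
From mathcomp Require Import all_classical all_reals all_analysis.
Set Implicit Arguments.
Unset Strict Implicit.
Unset Printing Implicit Defensive.
Import Order.TTheory GRing.Theory Num.Theory.
Import numFieldNormedType.Exports.
Local Open Scope classical_set_scope.
Local Open Scope ring_scope.

(** Points of the meridian plane are pairs [(r, z)]. The library norm on pairs
    is the sup norm; it is used only through the topology, boundedness and the
    limit at infinity. The Euclidean structure is given by [dot]. *)
Notation plane R := (R^o * R^o)%type.

Definition er {R : realType} : plane R := (1, 0).
Definition ez {R : realType} : plane R := (0, 1).

Definition dot {R : realType} (u v : plane R) : R := u.1 * v.1 + u.2 * v.2.

Definition half_plane {R : realType} : set (plane R) := [set p | 0 < p.1].

Definition closed_half_plane {R : realType} : set (plane R) :=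
  [set p | 0 <= p.1].

Definition boundary {R : realType} (E : set (plane R)) : set (plane R) :=
  closure E `\` E°.

Definition exterior {R : realType} (E : set (plane R)) : set (plane R) :=
  half_plane `\` closure E.

(** Differential operators *)

Definition grad {R : realType} (f : plane R -> R^o) (p : plane R) : plane R :=
  ('D_er f p, 'D_ez f p).

Definition div {R : realType} (F : plane R -> plane R) (p : plane R) : R :=
  'D_er (fun q => (F q).1) p + 'D_ez (fun q => (F q).2) p.

Definition C1_on {R : realType} (U : set (plane R)) (f : plane R -> R^o) :=
  forall p, U p -> [/\ derivable f p er, derivable f p ez &
    {for p, continuous (grad f)}].

Definition C2_on {R : realType} (U : set (plane R)) (f : plane R -> R^o) :=
  [/\ C1_on U f, C1_on U (fun p => 'D_er f p) & C1_on U (fun p => 'D_ez f p)].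

(** One-sided directional derivative at [p] from the side [n p] points to. *)
Definition normal_derive {R : realType} (n : plane R -> plane R)
    (f : plane R -> R^o) (p : plane R) : R :=
  lim (t^-1 * (f (p + t *: n p) - f p) @[t --> (0 : R)^'+]).

(** The cross-section *)

(** [C2_boundary E c L]: the boundary of [E] is a simple closed curve of class
    C^2 and of length [L], parametrised by arc length by [c]. *)
Record C2_boundary {R : realType} (E : set (plane R)) (c : R -> plane R)
    (L : R) : Prop := {
  c2b_length : 0 < L;
  c2b_derivable : forall s : R, derivable c s 1;
  c2b_derivable2 : forall s : R, derivable (derive1 c) s 1;
  c2b_continuous2 : continuous (derive1 (derive1 c));
  c2b_periodic : forall s, c (s + L) = c s;
  c2b_simple : {in `[0, L[ &, injective c};
  c2b_range : range c = boundary E;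
  c2b_unit_speed : forall s, dot (derive1 c s) (derive1 c s) = 1 }.

Record cross_section {R : realType} (E : set (plane R)) (c : R -> plane R)
    (L : R) : Prop := {
  cs_bounded : bounded_set E;
  cs_convex : convex_set E;
  cs_interior : E° !=set0;
  cs_half_plane : closure E `<=` half_plane;
  cs_C2 : C2_boundary E c L;
  cs_symmetric : forall r z, E (r, z) <-> E (r, - z) }.

Definition outer_unit_normal {R : realType} (E : set (plane R))
    (c : R -> plane R) (n : plane R -> plane R) : Prop :=
  forall s, [/\ dot (n (c s)) (n (c s)) = 1, dot (n (c s)) (derive1 c s) = 0 &
    \forall t \near (0 : R)^'+, exterior E (c s + t *: n (c s))].

(** Frenet's formula for the arc-length parametrisation reads
    [c'' = - kappa n], whatever the orientation of [c]; with the outer normal,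
    [kappa >= 0] for convex [E]. *)
Definition curvature {R : realType} (c : R -> plane R) (n : plane R -> plane R)
    (s : R) : R := - dot (derive1 (derive1 c) s) (n (c s)).

Definition ring_curvature {R : realType} (c : R -> plane R)
    (n : plane R -> plane R) (s : R) : R :=
  curvature c n s + dot (n (c s)) er / (c s).1.

(** The free boundary problem *)

(** Classical regularity of [psi], a function on the closed half-plane minus
    [E°] (its values elsewhere are irrelevant): C^2 in the exterior, continuous
    up to the boundary of [E] and up to the axis, and with a gradient extending
    continuously up to the boundary of [E]. *)
Record classical {R : realType} (E : set (plane R)) (psi : plane R -> R^o)
    : Prop := {
  cl_C2 : C2_on (exterior E) psi;
  cl_continuous : {within closed_half_plane `\` E°, continuous psi};
  cl_C1_up_to : exists G : plane R -> plane R,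
    {within half_plane `\` E°, continuous G} /\ {in exterior E, G =1 grad psi} }.

Definition Psi {R : realType} (psi : plane R -> R^o) (W : R) : plane R -> R^o :=
  fun p => psi p - W / 2 * p.1 ^+ 2.

Record bubble_ring {R : realType} (sigma rho : R) (E : set (plane R))
    (c : R -> plane R) (n : plane R -> plane R) (psi : plane R -> R^o)
    (W gamma lambda : R) : Prop := {
  br_classical : classical E psi;
  br_pde : forall p, exterior E p ->
    - div (fun q => q.1^-1 *: grad psi q) p = 0;
  br_dirichlet : forall p, boundary E p -> Psi psi W p = gamma;
  br_jump : forall s,
    2 * sigma * ring_curvature c n s
    - rho * ((c s).1^-1 * normal_derive n psi (c s)
             - W * dot (n (c s)) er) ^+ 2
    + lambda = 0;
  br_axis : forall z, psi (0, z) = 0;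
  br_infinity : forall e : R, 0 < e -> exists M : R, forall p : plane R,
    (closed_half_plane `\` E°) p -> M < `|p| -> `|psi p| < e }.

(** Geometric and physical quantities. The area integrals are taken over [E°],
    which differs from the convex set [E] by a Lebesgue-null set: [E] need not
    be Borel, hence not measurable for the product sigma-algebra. *)

Notation area_measure R := (@lebesgue_measure R \x @lebesgue_measure R)%E.

Definition area {R : realType} (E : set (plane R)) : R :=
  fine (area_measure R E°).

Definition area_integral {R : realType} (E : set (plane R))
    (f : plane R -> R) : R :=
  \int[area_measure R]_(p in E°) f p.

Definition arc_integral {R : realType} (c : R -> plane R) (L : R)
    (f : plane R -> R) : R :=
  \int[lebesgue_measure]_(s in `[0, L]) f (c s).

Definition circulation {R : realType} (c : R -> plane R) (L : R)
    (n : plane R -> plane R) (psi : plane R -> R^o) : R :=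
  - arc_integral c L (fun p => p.1^-1 * normal_derive n psi p).

Definition weber {R : realType} (sigma rho : R) (E : set (plane R))
    (c : R -> plane R) (L : R) (n : plane R -> plane R)
    (psi : plane R -> R^o) : R :=
  Num.sqrt (2 * pi) * rho * circulation c L n psi ^+ 2
  / (sigma * Num.sqrt (area E)).

Definition major_radius {R : realType} (E : set (plane R)) : R :=
  (area E)^-1 * area_integral E (fun p => p.1).

Definition delta {R : realType} (E : set (plane R)) : R :=
  area_integral E (fun p => (p.1 ^+ 2)^-1) - 2 * pi.

(* Main.v *)
Require Import Defs.
From mathcomp Require Import all_boot all_order all_algebra.
From mathcomp Require Import all_classical all_reals all_analysis.
From mathcomp Require Import measurable_realfun ring lra zify.
Set Implicit Arguments.
Unset Strict Implicit.
Unset Printing Implicit Defensive.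
Import Order.TTheory GRing.Theory Num.Theory.
Import numFieldNormedType.Exports.
Local Open Scope classical_set_scope.
Local Open Scope ring_scope.

(** Only the boundary conditions matter. Write [q] for
    [r^-1 * d_n psi - W * n_r = r^-1 * d_n Psi <= 0], so that the jump condition
    reads [rho * q ^ 2 = 2 * sigma * (kappa + n_r / r) + lambda]. Integrating it
    along the boundary, with total curvature at most [2 * pi] and
    [int_E r^-2 = - int n_r / r], gives [lambda * L >= 2 * sigma * delta].
    By the symmetry of [E], the part of the boundary to the right of the
    vertical chord through its top and bottom points is an arc on which
    [n_r >= 0]; there [kappa >= 0], [r <= rmax] and [n_r <= 1] give
    [- q >= n_r * sqrt ((2 * sigma / rmax + lambda) / rho)]. The integral of
    [n_r] over this arc is the height [h] of [E], and [q <= 0] elsewhere, so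
    [rho * beta ^ 2 >= h ^ 2 * (2 * sigma / rmax + lambda)].
    By convexity, [rmax] is at most [32 * R], and the assumption
    [2 * pi * R ^ 2 <= |E| <= h * rmax] bounds [rmax], hence also [L] and
    [sqrt |E|], by multiples of [h]. *)

(** * Calculus in one variable *)

Section calculus.
Context {R : realType}.
Implicit Types (f g df dg : R -> R) (a b x : R).

(** Every boundary integral is treated as the increment over one period of a primitive along [c], so
    that inequalities between integrals become inequalities between derivatives. The continuity of
    [q] that this needs is read off the jump condition: since [q <= 0], it exhibits [q] as minus a
    square root. The integrands of [- beta] and of [q] differ by [W * n_r], whose integral over a
    closed curve is zero; the sign of [q] then excludes cancellation in [beta]. The bound
    [lambda * L >= 2 * sigma * delta] is useful only once [delta >= 0]. By Jensen,
    [int_E r^-2 >= |E| / R ^ 2], and this is at least [2 * pi] by the hypothesis on [R], which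
    therefore enters twice: here and in the comparison of [rmax] with [h]. Convexity enters through
    supporting lines. The normal is assumed only to point outward locally, at each point separately;
    its coherent orientation, [kappa >= 0] and the signs of [n_r] on the two arcs are all derived
    from the global support inequality. *)

Lemma is_derive1_continuous f x d : is_derive x 1 f d -> {for x, continuous f}.
Proof. by move=> [h _]; apply/differentiable_continuous/derivable1_diffP. Qed.

Lemma cts_add f g : continuous f -> continuous g ->
  continuous (fun x => f x + g x).
Proof. by move=> cf cg x; apply: cvgD; [exact: cf|exact: cg]. Qed.

Lemma cts_opp f : continuous f -> continuous (fun x => - f x).
Proof. by move=> cf x; apply: cvgN; exact: cf. Qed.

Lemma cts_sub f g : continuous f -> continuous g ->
  continuous (fun x => f x - g x).
Proof. by move=> cf cg x; apply: cvgB; [exact: cf|exact: cg]. Qed.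

Lemma cts_mul f g : continuous f -> continuous g ->
  continuous (fun x => f x * g x).
Proof. by move=> cf cg x; apply: cvgM; [exact: cf|exact: cg]. Qed.

Lemma cts_cst (k : R) : continuous (fun _ : R => k).
Proof. by move=> x; exact: cvg_cst. Qed.

Lemma cts_inv f : (forall x, f x != 0) -> continuous f ->
  continuous (fun x => (f x)^-1).
Proof. by move=> f0 cf x; apply: cvgV; [exact: f0|exact: cf]. Qed.

Lemma is_deriv_add f g x d e : is_derive x 1 f d -> is_derive x 1 g e ->
  is_derive x 1 (fun y => f y + g y) (d + e).
Proof. exact: is_deriveD. Qed.

Lemma is_deriv_opp f x d : is_derive x 1 f d ->
  is_derive x 1 (fun y => - f y) (- d).
Proof. exact: is_deriveN. Qed.

Lemma is_deriv_sub f g x d e : is_derive x 1 f d -> is_derive x 1 g e ->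
  is_derive x 1 (fun y => f y - g y) (d - e).
Proof. exact: is_deriveB. Qed.

Lemma is_deriv_mul f g x d e : is_derive x 1 f d -> is_derive x 1 g e ->
  is_derive x 1 (fun y => f y * g y) (d * g x + f x * e).
Proof.
move=> hf hg; apply: (is_derive_eq (is_deriveM hf hg)).
by rewrite /GRing.scale /= addrC mulrC [_ * g x]mulrC.
Qed.

Lemma is_deriv_scale f x d k : is_derive x 1 f d ->
  is_derive x 1 (fun y => k * f y) (k * d).
Proof. by move=> h; apply: (is_derive_eq (is_deriveZ k h)). Qed.

Lemma is_deriv_comp f g x d e : is_derive x 1 g e -> is_derive (g x) 1 f d ->
  is_derive x 1 (fun y => f (g y)) (d * e).
Proof.
by move=> hg hf; apply: (is_derive_eq (is_derive1_comp hf hg)).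
Qed.

Lemma is_deriv_div f g x d e : g x != 0 -> is_derive x 1 f d ->
  is_derive x 1 g e ->
  is_derive x 1 (fun y => f y / g y) ((d * g x - f x * e) / g x ^+ 2).
Proof.
move=> g0 hf hg.
have hV := is_deriveV g0 hg.
apply: (is_derive_eq (is_deriv_mul hf hV)); rewrite /GRing.scale /=.
by field.
Qed.

Lemma deriv_MVT f df a b : a <= b ->
  (forall x, a <= x <= b -> is_derive x 1 f (df x)) ->
  exists2 x, a <= x <= b & f b - f a = df x * (b - a).
Proof.
move=> ab hd; have cf : {within `[a, b], continuous f}.
  apply: continuous_in_subspaceT => x; rewrite inE /= in_itv /= => h.
  exact: is_derive1_continuous (hd x h).
have [|x] := @MVT_segment _ f df a b ab _ cf.
  by move=> x; rewrite in_itv /= => /andP[/ltW ax /ltW xb]; apply: hd; rewrite ax.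
by rewrite in_itv /=; exists x.
Qed.

Lemma ge0_deriv_le f df a b : a <= b ->
  (forall x, a <= x <= b -> is_derive x 1 f (df x)) ->
  (forall x, a < x < b -> 0 <= df x) -> f a <= f b.
Proof.
move=> ab hd h0; have cf : {within `[a, b], continuous f}.
  apply: continuous_in_subspaceT => x; rewrite inE /= in_itv /= => h.
  exact: is_derive1_continuous (hd x h).
have [] := @MVT_segment _ f df a b ab _ cf.
  by move=> x; rewrite in_itv /= => /andP[/ltW ax /ltW xb]; apply: hd; rewrite ax.
rewrite le_eqVlt in ab; case/orP: ab => [/eqP <- //|ab].
have [] := @MVT _ f df a b ab _ cf.
  by move=> x; rewrite in_itv /= => /andP[/ltW ax /ltW xb]; apply: hd; rewrite ax.
move=> c; rewrite in_itv /= => cab fe _ _ _.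
by rewrite -subr_ge0 fe mulr_ge0 ?h0// subr_ge0 ltW.
Qed.

Lemma deriv_le f g df dg a b : a <= b ->
  (forall x, a <= x <= b -> is_derive x 1 f (df x)) ->
  (forall x, a <= x <= b -> is_derive x 1 g (dg x)) ->
  (forall x, a < x < b -> df x <= dg x) -> f b - f a <= g b - g a.
Proof.
move=> ab hf hg h; have := @ge0_deriv_le (fun x => g x - f x)
  (fun x => dg x - df x) a b ab.
have -> : (f b - f a <= g b - g a) = (g a - f a <= g b - f b) by lra.
apply=> x hx; first by apply: is_deriv_sub; [exact: hg|exact: hf].
by rewrite subr_ge0 h.
Qed.

Lemma deriv_eq f g df a b : a <= b ->
  (forall x, a <= x <= b -> is_derive x 1 f (df x)) ->
  (forall x, a <= x <= b -> is_derive x 1 g (df x)) -> f b - f a = g b - g a.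
Proof.
by move=> ab hf hg; apply/le_anti/andP; split;
  apply: (@deriv_le _ _ df df).
Qed.

Lemma deriv_lipschitz f df a b (k : R) : a <= b ->
  (forall x : R, is_derive x 1 f (df x)) -> (forall x, `|df x| <= k) ->
  `|f b - f a| <= k * (b - a).
Proof.
move=> ab hf hk.
have [x _ ->] : exists2 x : R, x \in `[a, b] & f b - f a = df x * (b - a).
  apply: MVT_segment => //.
  by apply: continuous_subspaceT => x; exact: is_derive1_continuous (hf x).
have ab0 : 0 <= b - a by rewrite subr_ge0.
by rewrite normrM (ger0_norm ab0) ler_wpM2r.
Qed.

Lemma inv_sq_primitive h H a x : 0 < a -> a <= x ->
  (forall y, a <= y -> h y = (y ^+ 2)^-1) ->
  (forall y : R, is_derive y 1 H (h y)) -> H x - H a = a^-1 - x^-1.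
Proof.
move=> a0 ax hE dH.
have dinv (y : R) : a <= y <= x -> is_derive y 1 (fun y => - (1 / y)) (h y).
  move=> /andP[ay _]; have y0 : y != 0 by rewrite gt_eqF// (lt_le_trans a0).
  have d1 : is_derive y 1 (fun=> 1 : R) 0 by exact: is_derive_cst.
  have d2 : is_derive y 1 (fun y : R => y) 1 by exact: is_derive_id.
  apply: (is_derive_eq (is_deriv_opp (is_deriv_div y0 d1 d2))).
  by rewrite hE//; field.
have := @deriv_eq H (fun y => - (1 / y)) h a x ax (fun y _ => dH y) dinv.
by rewrite !div1r => ->; rewrite opprK addrC.
Qed.

Lemma continuous_itv_integrable f a b : continuous f ->
  lebesgue_measure.-integrable `[a, b] (EFin \o f).
Proof.
move=> cf; apply: continuous_compact_integrable; first exact: segment_compact.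
exact: continuous_subspaceT.
Qed.

Lemma primitive_right f a : continuous f -> exists F : R -> R,
  forall x, a < x -> is_derive x 1 F (f x).
Proof.
move=> cf; exists (fun x => \int[lebesgue_measure]_(t in `[a, x]) f t) => x ax.
have xu : x < x + 1 by rewrite ltrDl.
have ax' : (BLeft a < BRight x)%E by rewrite lte_fin.
have [d e] := continuous_FTC1 xu (continuous_itv_integrable a (x + 1) cf) ax' (cf x).
by rewrite -e derive1E; exact: derivableP.
Qed.

(** An integral from a base point is differentiated only to the right of that point. A second
    primitive, obtained from [x => f (- x)], covers the left; on the overlap []-1, 1[] the two
    differ by a constant and can be glued at [0]. *)
Lemma primitive f : continuous f -> exists F : R -> R,
  forall x, is_derive x 1 F (f x).
Proof.
move=> cf.
have [F hF] := primitive_right (-1) cf.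
have [G hG] : exists G : R -> R, forall x, x < 1 -> is_derive x 1 G (f x).
  have cf' : continuous (fun x => f (- x)).
    by move=> x; apply: continuous_comp; [exact: opp_continuous|exact: cf].
  have [G hG] := primitive_right (-1) cf'.
  exists (fun x => - G (- x)) => x x1.
  have h : is_derive (- x) 1 G (f x) by rewrite -{2}[x]opprK; apply: hG; lra.
  apply: (is_derive_eq (is_deriv_opp (is_deriv_comp _ h))).
  by rewrite mulrN mulr1 opprK.
have FG x : -1 < x < 1 -> F x - F 0 = G x - G 0.
  move=> /andP[x1 x2]; have [x0|/ltW x0] := leP 0 x.
    apply: (@deriv_eq _ _ f) => // y /andP[y0 yx]; [apply: hF|apply: hG]; lra.
  suff : F 0 - F x = G 0 - G x by lra.
  apply: (@deriv_eq _ _ f) => // y /andP[y0 yx]; [apply: hF|apply: hG]; lra.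
exists (fun x => if x < 0 then G x - G 0 else F x - F 0) => x.
(* The case split is at [2^-1], away from the gluing point [0], so that in each case a single
   formula holds on a whole neighbourhood of [x]. *)
have [x0|x0] := ltP x (2^-1).
  apply: (@near_eq_is_derive _ _ _ (fun x => G x - G 0)).
  - have : \forall y \near x, y < 1 by apply: lt_nbhsl; lra.
    apply: filterS => y y1; case: ltP => // y0.
    by rewrite FG// y1 andbT; lra.
  - rewrite -[f x]subr0; apply: is_deriv_sub; first by apply: hG; lra.
apply: (@near_eq_is_derive _ _ _ (fun x => F x - F 0)).
- have : \forall y \near x, 0 < y by apply: lt_nbhsr; lra.
  by apply: filterS => y y1; case: ltP => // y0; lra.
- rewrite -[f x]subr0; apply: is_deriv_sub; first by apply: hF; lra.
Qed.

Lemma Rintegral_primitive f F a b : a < b -> continuous f ->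
  (forall x, is_derive x 1 F (f x)) ->
  \int[lebesgue_measure]_(x in `[a, b]) f x = F b - F a.
Proof.
move=> ab cf hF; rewrite /Rintegral (@continuous_FTC2 _ f F a b)//.
- exact: continuous_subspaceT.
- split.
  + by move=> x _; case: (hF x).
  + by apply: cvg_at_right_filter; exact: is_derive1_continuous (hF a).
  + by apply: cvg_at_left_filter; exact: is_derive1_continuous (hF b).
- by move=> x _; rewrite derive1E; exact: (@derive_val _ _ _ _ _ _ _ (hF x)).
Qed.

Lemma periodic_primitive f F L : (forall x, f (x + L) = f x) ->
  (forall x, is_derive x 1 F (f x)) ->
  forall a b, F (a + L) - F a = F (b + L) - F b.
Proof.
move=> pf hF; suff h a b : a <= b -> F (a + L) - F a = F (b + L) - F b.
  by move=> a b; case/orP: (le_total a b) => /h.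
move=> ab; suff : F (b + L) - F (a + L) = F b - F a by lra.
apply: (@deriv_eq (fun x => F (x + L)) F f) => // x _.
rewrite -[f x]mulr1 -[in f x](pf x); apply: is_deriv_comp => //.
exact: is_derive_shift.
Qed.

(** Over [n + 1] equal steps the increments add up to at most [C * (b - a) ^ 2 / (n + 1)], which
    tends to [0]. This serves as a monotonicity criterion for functions that are not known to be
    differentiable. *)
Lemma quadratic_increments_le f a b C : a <= b ->
  (forall x y, a <= x -> x <= y -> y <= b -> f y - f x <= C * (y - x) ^+ 2) ->
  f b <= f a.
Proof.
move=> ab h; rewrite -subr_le0.
have hn (n : nat) : f b - f a <= C * (b - a) ^+ 2 / n.+1%:R.
  pose p (i : nat) := a + i%:R * ((b - a) / n.+1%:R).
  have n0 : (n.+1%:R : R) != 0 by rewrite pnatr_eq0.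
  have n1 : (0 : R) < n.+1%:R by rewrite ltr0n.
  have pn : p n.+1 = b by rewrite /p; field; rewrite ?[1 + _]addrC ?natr1.
  have p0 : p 0%N = a by rewrite /p mul0r addr0.
  have pS i : p i.+1 - p i = (b - a) / n.+1%:R.
    by rewrite /p -natr1; ring.
  have q0 : 0 <= (b - a) / n.+1%:R by rewrite divr_ge0// ?subr_ge0// ltW.
  have pm i : p i <= p i.+1 by rewrite -subr_ge0 pS.
  have pa i : a <= p i by rewrite /p lerDl mulr_ge0.
  have pb i : (i <= n.+1)%N -> p i <= b.
    by rewrite -[leRHS]pn /p => hi; rewrite lerD2l ler_wpM2r// ler_nat.
  have hs i : (i <= n.+1)%N ->
      f (p i) - f a <= i%:R * (C * ((b - a) / n.+1%:R) ^+ 2).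
    elim: i => [|i IH] hi; first by rewrite p0 subrr mul0r.
    have := IH (ltnW hi); have := h _ _ (pa i) (pm i) (pb _ hi).
    by rewrite pS -natr1; lra.
  have := hs _ (leqnn n.+1); rewrite pn.
  suff -> : n.+1%:R * (C * ((b - a) / n.+1%:R) ^+ 2) =
    C * (b - a) ^+ 2 / n.+1%:R by [].
  by field; rewrite ?[1 + _]addrC ?natr1.
rewrite leNgt; apply/negP => pos.
have [n hlt] : exists n : nat, C * (b - a) ^+ 2 / (f b - f a) < n%:R.
  by exists (Num.trunc (C * (b - a) ^+ 2 / (f b - f a))).+1; exact: truncnS_gt.
have := hn n; rewrite ler_pdivlMr ?ltr0n// leNgt => /negP; apply.
rewrite ltr_pdivrMr// in hlt; apply: (lt_le_trans hlt).
by rewrite mulrC ler_wpM2l// ?(ltW pos)// ler_nat.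
Qed.

Lemma is_derive_approx f x d (e : R) : is_derive x 1 f d -> 0 < e ->
  exists2 del : R, 0 < del &
    forall h : R, `|h| < del -> `|f (x + h) - f x - h * d| <= e * `|h|.
Proof.
move=> [hd <-] e0.
have /cvgrPdist_le/(_ e e0) : h^-1 *: (f (h + x) - f x) @[h --> 0^'] --> 'D_1 f x.
  by move: hd; rewrite /derivable /derive; under eq_fun do rewrite [_%:A]mulr1.
move=> /nbhs_ballP[del del0 hdel]; exists del => // h hh.
have [->|h0] := eqVneq h 0; first by rewrite addr0 mul0r subrr subr0 normr0 mulr0.
have := hdel h; rewrite -ball_normE /= sub0r normrN => /(_ hh h0) hle.
rewrite distrC (_ : _ - _ = h * ('D_1 f x - h^-1 *: (f (h + x) - f x))).
  by rewrite normrM mulrC ler_wpM2r.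
by rewrite /GRing.scale /= mulrBr mulVKf// [h + x]addrC.
Qed.

(** If [k] were positive, [f1 t] would be at least [k / 2 * (t - s)] just to the right of [s], and
    [f] would exceed [f s] by [k / 4 * (t - s) ^ 2] there. *)
Lemma second_derivative_max_le0 f f1 (s k : R) :
  (forall t : R, is_derive t 1 f (f1 t)) -> is_derive s 1 f1 k -> f1 s = 0 ->
  (forall t, f t <= f s) -> k <= 0.
Proof.
move=> df df1 f1s fmax; rewrite leNgt; apply/negP => k0.
have k2 : 0 < k / 2 by rewrite divr_gt0.
have [del del0 hdel] := is_derive_approx df1 k2.
have ge t : s <= t <= s + del / 2 -> k / 2 * (t - s) <= f1 t.
  move=> /andP[st ts]; have := hdel (t - s).
  have e1 : s + (t - s) = t by rewrite addrC subrK.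
  have e2 : `|t - s| = t - s by rewrite ger0_norm// subr_ge0.
  have e3 : t - s < del by lra.
  by rewrite e1 e2 f1s subr0 => /(_ e3); rewrite ler_norml => /andP[+ _]; lra.
have hle : s <= s + del / 2 by lra.
have := @deriv_le (fun t => k / 4 * ((t - s) * (t - s))) f
  (fun t => k / 4 * (1 * (t - s) + (t - s) * 1)) f1 s (s + del / 2) hle.
have h1 (t : R) : s <= t <= s + del / 2 -> is_derive t 1
    (fun t => k / 4 * ((t - s) * (t - s))) (k / 4 * (1 * (t - s) + (t - s) * 1)).
  move=> _; apply: is_deriv_scale.
  have h : is_derive t 1 (fun t : R => t - s) 1.
    by rewrite -[1 in X in is_derive _ _ _ X]subr0; apply: is_deriv_sub.
  exact: is_deriv_mul.
have h2 t : s < t < s + del / 2 -> k / 4 * (1 * (t - s) + (t - s) * 1) <= f1 t.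
  by move=> /andP[/ltW h1' /ltW h2']; have := ge t; rewrite h1' h2' => /(_ isT); lra.
move=> /(_ h1 (fun x _ => df x) h2).
have := fmax (s + del / 2).
have : 0 < k / 4 * (del / 2 * (del / 2)) by rewrite mulr_gt0// ?mulr_gt0//; lra.
lra.
Qed.

Lemma nonvanishing_sign f : continuous f -> (forall x, f x != 0) ->
  (forall x, 0 < f x) \/ (forall x, f x < 0).
Proof.
move=> cf f0; have key a b : a <= b -> (0 < f a) = (0 < f b).
  move=> ab; apply/idP/idP => h; rewrite ltNge; apply/negP => h'.
    have [|x _ /eqP] := IVT (v := 0) ab (continuous_subspaceT cf).
      by rewrite ge_min le_max h' orbT ltW.
    by apply/negP.
  have [|x _ /eqP] := IVT (v := 0) ab (continuous_subspaceT cf).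
    by rewrite ge_min le_max h' /= (ltW h) orbT.
  by apply/negP.
have key' a : (0 < f a) = (0 < f 0).
  by have [/key|/ltW/key] := leP 0 a.
have [h|h] := ltP 0 (f 0); [left|right] => x; first by rewrite key'.
by rewrite lt_neqAle f0/= leNgt key' -leNgt.
Qed.

End calculus.

(** * Convex sets in the plane *)

Section plane_topology.
Context {R : realType}.
Implicit Types (E : set (plane R)) (p q x y : plane R).

Lemma nbhs_boxP p E : nbhs p E <-> exists e : R, 0 < e /\
  forall q, `|q.1 - p.1| < e -> `|q.2 - p.2| < e -> E q.
Proof.
split=> [/nbhs_ballP[e e0 h]|[e [e0 h]]].
  exists e; split=> // q h1 h2; apply: h; split.
    by rewrite -ball_normE /= distrC.
  by rewrite -ball_normE /= distrC.
apply/nbhs_ballP; exists e => // q [h1 h2]; apply: h.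
  by move: h1; rewrite -ball_normE /= distrC.
by move: h2; rewrite -ball_normE /= distrC.
Qed.

Lemma closure_boxP p E : closure E p <-> forall e : R, 0 < e ->
  exists q, [/\ E q, `|q.1 - p.1| < e & `|q.2 - p.2| < e].
Proof.
split=> [h e e0|h B /nbhs_boxP[e [e0 hB]]].
  have [|q [Eq [h1 h2]]] := h [set q | `|q.1 - p.1| < e /\ `|q.2 - p.2| < e].
    by apply/nbhs_boxP; exists e; split.
  by exists q.
by have [q [Eq h1 h2]] := h e e0; exists q; split=> //; apply: hB.
Qed.

Lemma convex_plane E p q x (t : R) : convex_set E -> 0 <= t -> t <= 1 ->
  E p -> E q -> x.1 = (1 - t) * p.1 + t * q.1 ->
  x.2 = (1 - t) * p.2 + t * q.2 -> E x.
Proof.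
move=> cE t0 t1 Ep Eq x1 x2.
pose t' : {i01 R} := Itv01 t0 t1.
have := cE q p t'; rewrite !inE => /(_ Eq Ep).
suff -> : x = conv t' (q : convex_lmodType (plane R)) p by [].
case: x x1 x2 => a b /= -> ->.
by apply/pair_equal_spec; split; rewrite addrC.
Qed.

Lemma convex_closure E p q x (t : R) : convex_set E -> 0 <= t -> t <= 1 ->
  closure E p -> closure E q -> x.1 = (1 - t) * p.1 + t * q.1 ->
  x.2 = (1 - t) * p.2 + t * q.2 -> closure E x.
Proof.
move=> cE t0 t1 /closure_boxP cp /closure_boxP cq x1 x2.
apply/closure_boxP => e e0.
have e2 : 0 < e / 2 by rewrite divr_gt0.
have [p' [Ep p1 p2]] := cp _ e2; have [q' [Eq q1 q2]] := cq _ e2.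
exists ((1 - t) * p'.1 + t * q'.1, (1 - t) * p'.2 + t * q'.2) => /=; split.
- exact: (convex_plane cE t0 t1 Ep Eq).
- rewrite x1; move: p1 q1; rewrite !ltr_distl => /andP[/ltW ? /ltW ?] /andP[/ltW ? /ltW ?].
  by apply/andP; split; nra.
- rewrite x2; move: p2 q2; rewrite !ltr_distl => /andP[/ltW ? /ltW ?] /andP[/ltW ? /ltW ?].
  by apply/andP; split; nra.
Qed.

Lemma convex_interior E p q x (t : R) : convex_set E -> 0 <= t -> t < 1 ->
  E° p -> closure E q -> x.1 = (1 - t) * p.1 + t * q.1 ->
  x.2 = (1 - t) * p.2 + t * q.2 -> E° x.
Proof.
move=> cE t0 t1 /nbhs_boxP[e [e0 he]] /closure_boxP cq x1 x2.
have t1' : 0 < 1 - t by rewrite subr_gt0.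
have d0 : 0 < e * (1 - t) / 2 by rewrite divr_gt0// mulr_gt0.
have [q' [Eq q1 q2]] := cq _ d0.
apply/nbhs_boxP; exists (e * (1 - t) / 2); split=> // y y1 y2.
(* A point [y] near [x] is written as a combination with weights [1 - t] and [t] of [p'] and [q'],
   where [q'] in [E] approximates [q]. Solving for [p'] gives an error below [(1 + t) * d / (1 - t)]
   with [d = e * (1 - t) / 2], hence below [e]. *)
apply: (@convex_plane E ((y.1 - t * q'.1) / (1 - t), (y.2 - t * q'.2) / (1 - t))
  q' y t) => //.
- exact: ltW.
- apply: he => /=.
  + have -> : (y.1 - t * q'.1) / (1 - t) - p.1
      = (y.1 - x.1 - t * (q'.1 - q.1)) / (1 - t) by rewrite x1; field; lra.
    rewrite normrM normfV (gtr0_norm t1') ltr_pdivrMr//.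
    move: y1 q1; rewrite ltr_norml !ltr_distl => /andP[? ?] /andP[? ?].
    by apply/andP; split; nra.
  + have -> : (y.2 - t * q'.2) / (1 - t) - p.2
      = (y.2 - x.2 - t * (q'.2 - q.2)) / (1 - t) by rewrite x2; field; lra.
    rewrite normrM normfV (gtr0_norm t1') ltr_pdivrMr//.
    move: y2 q2; rewrite ltr_norml !ltr_distl => /andP[? ?] /andP[? ?].
    by apply/andP; split; nra.
- by rewrite /=; field; lra.
- by rewrite /=; field; lra.
Qed.

Lemma interior_closure E p : E° p -> closure E p.
Proof. by move=> /interior_subset/subset_closure. Qed.

Lemma is_derive_fst (c : R -> plane R) (s : R) : derivable c s 1 ->
  is_derive s 1 (fun s => (c s).1 : R) (derive1 c s).1.
Proof.
move=> hc; have {}hc : h^-1 *: (c (h + s) - c s) @[h --> 0^'] --> derive1 c s.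
  rewrite /derive1; move: hc; rewrite /derivable /=.
  by under eq_fun do rewrite [_%:A]mulr1.
have h1 : h^-1 *: ((c (h + s)).1 - (c s).1) @[h --> 0^'] --> (derive1 c s).1.
  exact: (cvg_comp _ _ hc (@cvg_fst _ _ (nbhs _) (nbhs _) _)).
apply: DeriveDef.
  apply/cvg_ex; exists (derive1 c s).1.
  by under eq_fun do rewrite [_%:A]mulr1.
by rewrite -derive1E; apply/cvg_lim.
Qed.

Lemma is_derive_snd (c : R -> plane R) (s : R) : derivable c s 1 ->
  is_derive s 1 (fun s => (c s).2 : R) (derive1 c s).2.
Proof.
move=> hc; have {}hc : h^-1 *: (c (h + s) - c s) @[h --> 0^'] --> derive1 c s.
  rewrite /derive1; move: hc; rewrite /derivable /=.
  by under eq_fun do rewrite [_%:A]mulr1.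
have h1 : h^-1 *: ((c (h + s)).2 - (c s).2) @[h --> 0^'] --> (derive1 c s).2.
  exact: (cvg_comp _ _ hc (@cvg_snd _ _ (nbhs _) (nbhs _) _)).
apply: DeriveDef.
  apply/cvg_ex; exists (derive1 c s).2.
  by under eq_fun do rewrite [_%:A]mulr1.
by rewrite -derive1E; apply/cvg_lim.
Qed.

Lemma continuous_fst (c : R -> plane R) : continuous c ->
  continuous (fun s => (c s).1 : R).
Proof.
by move=> hc s; exact: (cvg_comp _ _ (hc s) (@cvg_fst _ _ (nbhs _) (nbhs _) _)).
Qed.

Lemma continuous_snd (c : R -> plane R) : continuous c ->
  continuous (fun s => (c s).2 : R).
Proof.
by move=> hc s; exact: (cvg_comp _ _ (hc s) (@cvg_snd _ _ (nbhs _) (nbhs _) _)).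
Qed.

End plane_topology.

(** * The boundary curve of a convex cross-section *)

(* [q] lies behind [p] in direction [tau], at a distance of order [h] and with
   normal offset [o(h)], so the segment from [q] to [x] meets the ray from [p]
   along [nu]. *)
Lemma convex_inward_normal (R : realType) (E : set (plane R))
    (p nu tau x : plane R) (a b : R) :
  convex_set E -> 0 < a -> 0 <= b -> closure E x ->
  x.1 = p.1 + a * nu.1 + b * tau.1 -> x.2 = p.2 + a * nu.2 + b * tau.2 ->
  (forall e : R, 0 < e -> exists (h y m : R) (q : plane R),
    [/\ closure E q, q.1 = p.1 + m * nu.1 + y * tau.1 &
      q.2 = p.2 + m * nu.2 + y * tau.2] /\
    [/\ 0 < h, y <= - (h / 2) & `|m| <= e * h]) ->
  exists t : R, 0 < t /\ closure E (p + t *: nu).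
Proof.
move=> cE a0 b0 Ex x1 x2 hq.
have e0 : 0 < a / (4 * (b + 1)) by rewrite divr_gt0// mulr_gt0//; lra.
have [h [y [m [q [[Eq q1 q2] [h0 hy hm]]]]]] := hq _ e0.
have by0 : 0 < b - y by lra.
exists ((b * m - y * a) / (b - y)); split.
  rewrite divr_gt0//.
  have : b * `|m| <= a * h / 4.
    apply: (@le_trans _ _ (b * (a / (4 * (b + 1)) * h))); first by rewrite ler_wpM2l.
    have -> : b * (a / (4 * (b + 1)) * h) = a * h * b / (4 * (b + 1)) by field; lra.
    rewrite ler_pdivrMr; last lra.
    have : 0 <= a * h by rewrite mulr_ge0 ?ltW.
    nra.
  have : - `|m| <= m by rewrite lerNl -normrN ler_norm.
  have : 0 < a * h by rewrite mulr_gt0.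
  nra.
apply: (@convex_closure _ E q x _ (- y / (b - y))) => //.
- by rewrite divr_ge0//; lra.
- by rewrite ler_pdivrMr//; lra.
- by rewrite /= /GRing.scale /= q1 x1; field; lra.
- by rewrite /= /GRing.scale /= q2 x2; field; lra.
Qed.

(** This is the expansion of [(x, y)] in the orthonormal frame made of the normal [(e * v, - e * u)]
    and the tangent [sg * (u, v)], with [e] and [sg] signs. *)
Lemma orthonormal_frame (R : realType) (e sg u v x y : R) :
  e * e = 1 -> sg * sg = 1 -> u * u + v * v = 1 ->
  x = (e * v * x + - e * u * y) * (e * v) + sg * (u * x + v * y) * (sg * u) /\
  y = (e * v * x + - e * u * y) * (- e * u) + sg * (u * x + v * y) * (sg * v).
Proof.
move=> ee ss uv; split.
  have -> : (e * v * x + - e * u * y) * (e * v) + sg * (u * x + v * y) * (sg * u)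
    = (e * e) * (v * (v * x - u * y)) + (sg * sg) * (u * (u * x + v * y)) by ring.
  by rewrite ee ss !mul1r -[LHS]mulr1 -uv; ring.
have -> : (e * v * x + - e * u * y) * (- e * u) + sg * (u * x + v * y) * (sg * v)
  = (e * e) * (u * (u * y - v * x)) + (sg * sg) * (v * (u * x + v * y)) by ring.
by rewrite ee ss !mul1r -[LHS]mulr1 -uv; ring.
Qed.

Lemma norm_lincomb_le (R : realType) (a b x y k : R) :
  `|a| <= 1 -> `|b| <= 1 -> `|x| <= k -> `|y| <= k ->
  `|a * x + b * y| <= 2 * k.
Proof.
move=> ha hb hx hy; rewrite (le_trans (ler_normD _ _))// !normrM mulr_natl mulr2n.
by rewrite lerD// -[leRHS]mul1r ler_pM.
Qed.

Section cross_section_geometry.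
Context {R : realType} (E : set (plane R)) (c : R -> plane R) (L : R).
Context (n : plane R -> plane R).
Hypothesis cs : cross_section E c L.
Hypothesis on : outer_unit_normal E c n.

Let r s : R := (c s).1.
Let z s : R := (c s).2.
Let r1 s : R := (derive1 c s).1.
Let z1 s : R := (derive1 c s).2.
Let r2 s : R := (derive1 (derive1 c) s).1.
Let z2 s : R := (derive1 (derive1 c) s).2.

Lemma curve_deriv (s : R) : [/\ is_derive s 1 (r : R -> R) (r1 s),
  is_derive s 1 (z : R -> R) (z1 s),
  is_derive s 1 (r1 : R -> R) (r2 s) & is_derive s 1 (z1 : R -> R) (z2 s)].
Proof.
have C2 := cs_C2 cs; split.
- exact: is_derive_fst (@c2b_derivable _ _ _ _ C2 s).
- exact: is_derive_snd (@c2b_derivable _ _ _ _ C2 s).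
- exact: is_derive_fst (@c2b_derivable2 _ _ _ _ C2 s).
- exact: is_derive_snd (@c2b_derivable2 _ _ _ _ C2 s).
Qed.

Lemma curve_unit s : r1 s * r1 s + z1 s * z1 s = 1.
Proof. exact: (c2b_unit_speed (cs_C2 cs) s). Qed.

Lemma curve_deriv_norm_le s : `|r1 s| <= 1 /\ `|z1 s| <= 1.
Proof.
have u := curve_unit s.
by split; rewrite ler_norml; apply/andP; split; nra.
Qed.

Lemma curve_boundary s : boundary E (c s).
Proof. by rewrite -(c2b_range (cs_C2 cs)); exists s. Qed.

Lemma curve_closure s : closure E (c s).
Proof. by have [] := curve_boundary s. Qed.

Lemma normal_rotated s : exists e : R, [/\ e * e = 1,
  (n (c s)).1 = e * z1 s & (n (c s)).2 = - e * r1 s].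
Proof.
have [n1 nt _] := on s; have u := curve_unit s.
move: n1 nt; rewrite /dot -/(r1 s) -/(z1 s).
set a := (n (c s)).1; set b := (n (c s)).2 => n1 nt.
exists (a * z1 s - b * r1 s); split.
- have : (a * z1 s - b * r1 s) * (a * z1 s - b * r1 s) =
    (a * a + b * b) * (r1 s * r1 s + z1 s * z1 s) -
    (a * r1 s + b * z1 s) * (a * r1 s + b * z1 s) by ring.
  by rewrite n1 u nt => ->; ring.
- have : (a * z1 s - b * r1 s) * z1 s = a * (r1 s * r1 s + z1 s * z1 s) -
    r1 s * (a * r1 s + b * z1 s) by ring.
  by rewrite u nt => ->; ring.
- have : - (a * z1 s - b * r1 s) * r1 s = b * (r1 s * r1 s + z1 s * z1 s) -
    z1 s * (a * r1 s + b * z1 s) by ring.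
  by rewrite u nt => ->; ring.
Qed.

Lemma normal_norm_le s : `|(n (c s)).1| <= 1 /\ `|(n (c s)).2| <= 1.
Proof.
have [h _ _] := on s; rewrite /dot in h.
by split; rewrite ler_norml; apply/andP; split; nra.
Qed.

(** Suppose that [x] is strictly on the outer side of the tangent line. Curve points slightly behind
    [c s], seen in the tangential direction of [x], are joined to [x] by segments that meet the
    outward ray at positive distance. By convexity an initial piece of that ray lies in [closure E],
    whereas [outer_unit_normal] places it in the exterior. *)
Lemma normal_support s x : closure E x ->
  (n (c s)).1 * (x.1 - r s) + (n (c s)).2 * (x.2 - z s) <= 0.
Proof.
move=> Ex; rewrite leNgt; apply/negP => a0.
have cE := cs_convex cs.
have [e [ee n1 n2]] := normal_rotated s.
have u := curve_unit s.
have [_ _ next] := on s.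
set a := (X in 0 < X) in a0.
pose b := r1 s * (x.1 - r s) + z1 s * (x.2 - z s).
have approx eps : 0 < eps -> exists2 del : R, 0 < del & forall h, `|h| < del ->
  `|r (s + h) - r s - h * r1 s| <= eps * `|h| /\
  `|z (s + h) - z s - h * z1 s| <= eps * `|h|.
  move=> eps0; have [dr dz _ _] := curve_deriv s.
  have [d1 d10 h1] := is_derive_approx dr eps0.
  have [d2 d20 h2] := is_derive_approx dz eps0.
  exists (Num.min d1 d2); first by rewrite lt_min d10.
  by move=> h; rewrite lt_min => /andP[hh1 hh2]; split; [exact: h1|exact: h2].
have [r1b z1b] := (curve_deriv_norm_le s).
have nb := normal_norm_le s.
have [t [t0 Et]] : exists t : R, 0 < t /\ closure E (c s + t *: n (c s)).
  (* The sign [sg] turns the tangent towards [x]; the point behind is [c (s + h)] with [h] of the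
     opposite sign. *)
  have gen (sg : R) : sg * sg = 1 -> `|sg| = 1 -> 0 <= sg * b ->
      exists t : R, 0 < t /\ closure E (c s + t *: n (c s)).
    move=> sg1 sgn sgb.
    have frame q := orthonormal_frame (q.1 - r s) (q.2 - z s) ee sg1 u.
    apply: (@convex_inward_normal _ E (c s) (n (c s)) (sg * r1 s, sg * z1 s) x a (sg * b)) => //.
    - by rewrite /= /a /b n1 n2; have [+ _] := frame x; rewrite /r; lra.
    - by rewrite /= /a /b n1 n2; have [_ +] := frame x; rewrite /z; lra.
    move=> eps eps0.
    (* For a step of size [del / 2], the bound [eps / 2] keeps the normal offset within
       [eps * (del / 2)], and [4^-1] keeps the tangential coordinate below [- (del / 4)]. *)
    have eps1 : 0 < Num.min (eps / 2) (4^-1) by rewrite lt_min divr_gt0//=; lra.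
    have [del del0 hdel] := approx _ eps1.
    set k := Num.min _ _ in eps1 hdel.
    have k1 : k <= eps / 2 by rewrite ge_min lexx.
    have k2 : k <= 4^-1 by rewrite ge_min lexx orbT.
    pose h := - sg * (del / 2).
    have hh : `|h| = del / 2 by rewrite normrM normrN sgn mul1r gtr0_norm// divr_gt0.
    have hlt : `|h| < del by rewrite hh; lra.
    have [hr hz] := hdel h hlt.
    rewrite hh in hr hz.
    exists (del / 2), (sg * (r1 s * (r (s + h) - r s) + z1 s * (z (s + h) - z s))),
      ((n (c s)).1 * (r (s + h) - r s) + (n (c s)).2 * (z (s + h) - z s)), (c (s + h)).
    split; first split.
    - exact: curve_closure.
    - by rewrite /= n1 n2; have [+ _] := frame (c (s + h)); rewrite /r; lra.
    - by rewrite /= n1 n2; have [_ +] := frame (c (s + h)); rewrite /z; lra.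
    split.
    - by rewrite divr_gt0.
    - have := norm_lincomb_le r1b z1b hr hz.
      rewrite -[leLHS](mul1r) -{1}sgn -normrM => /(le_trans (ler_norm _)).
      have -> : sg * (r1 s * (r (s + h) - r s - h * r1 s) +
        z1 s * (z (s + h) - z s - h * z1 s)) =
        sg * (r1 s * (r (s + h) - r s) + z1 s * (z (s + h) - z s))
        - sg * h * (r1 s * r1 s + z1 s * z1 s) by ring.
      have -> : sg * h = - (del / 2) by rewrite /h mulrA mulrN sg1 mulN1r.
      rewrite u mulr1 => hy.
      have kd : k * del <= 4^-1 * del by rewrite ler_wpM2r// ltW.
      lra.
    - have := norm_lincomb_le nb.1 nb.2 hr hz.
      have -> : (n (c s)).1 * (r (s + h) - r s - h * r1 s) +
        (n (c s)).2 * (z (s + h) - z s - h * z1 s) =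
        (n (c s)).1 * (r (s + h) - r s) + (n (c s)).2 * (z (s + h) - z s).
        by rewrite n1 n2; ring.
      move=> /le_trans; apply; nra.
  have [b0|b0] := leP 0 b; first by apply: (gen 1); rewrite ?mul1r ?normr1.
  by apply: (gen (-1)); rewrite ?normrN ?normr1 ?mulN1r ?opprK// oppr_ge0 ltW.
have [t' [[[_ hex] tt0] t'0]] : exists t' : R,
    (exterior E (c s + t' *: n (c s)) /\ t' < t) /\ 0 < t'.
  apply: (@filter_ex _ (0 : R)^'+); apply: filterI; first apply: filterI => //.
  - exact: nbhs_right_lt.
  - exact: nbhs_right_gt.
apply: hex.
apply: (@convex_closure _ E (c s) (c s + t *: n (c s)) _ (t' / t)) => //.
- by rewrite divr_ge0// ltW.
- by rewrite ler_pdivrMr// mul1r ltW.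
- exact: curve_closure.
- by rewrite /= /GRing.scale /=; field; lra.
- by rewrite /= /GRing.scale /=; field; lra.
Qed.

(** An interior point may be moved by [e / 2] along the normal within [E], so the weak inequality
    holds with room [e / 2]. *)
Lemma normal_support_lt s x : E° x ->
  (n (c s)).1 * (x.1 - r s) + (n (c s)).2 * (x.2 - z s) < 0.
Proof.
move=> /nbhs_boxP[e [e0 hE]].
have [g [gg n1 n2]] := normal_rotated s; have u := curve_unit s.
have [r1b z1b] := (curve_deriv_norm_le s).
have : closure E (x.1 + e / 2 * (n (c s)).1, x.2 + e / 2 * (n (c s)).2).
  apply/subset_closure/hE => /=; rewrite [_ + _ - _]addrAC subrr add0r normrM.
    apply: (@le_lt_trans _ _ (e / 2)); last lra.
    have [? ?] := normal_norm_le s; rewrite gtr0_norm ?divr_gt0// ler_piMr//; lra.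
  apply: (@le_lt_trans _ _ (e / 2)); last lra.
  have [? ?] := normal_norm_le s; rewrite gtr0_norm ?divr_gt0// ler_piMr//; lra.
move=> /(normal_support s) /=.
have -> : (n (c s)).1 * (x.1 + e / 2 * (n (c s)).1 - r s) +
  (n (c s)).2 * (x.2 + e / 2 * (n (c s)).2 - z s) =
  (n (c s)).1 * (x.1 - r s) + (n (c s)).2 * (x.2 - z s) +
  e / 2 * ((n (c s)).1 * (n (c s)).1 + (n (c s)).2 * (n (c s)).2) by ring.
have -> : (n (c s)).1 * (n (c s)).1 + (n (c s)).2 * (n (c s)).2 = 1.
  by case: (on s).
lra.
Qed.

Lemma curve_continuous : [/\ continuous (r : R -> R), continuous (z : R -> R),
  continuous (r1 : R -> R) & continuous (z1 : R -> R)].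
Proof.
by split=> s; have [? ? ? ?] := curve_deriv s;
  apply: is_derive1_continuous; eassumption.
Qed.

Lemma curve_continuous2 : continuous (r2 : R -> R) /\ continuous (z2 : R -> R).
Proof.
have h := c2b_continuous2 (cs_C2 cs).
by split; [exact: continuous_fst|exact: continuous_snd].
Qed.

(** The normal is given pointwise, so its sign relative to the rotated tangent might jump. For a
    fixed interior point [p0], the determinant [D] of [c - p0] and the tangent satisfies [e * D > 0]
    by strict support; it is continuous and never zero, so its sign, and with it [e], is
    constant. *)
Lemma normal_oriented : exists e : R, [/\ e * e = 1,
  (forall s, (n (c s)).1 = e * z1 s) & (forall s, (n (c s)).2 = - e * r1 s)].
Proof.
have [p0 Ep0] := cs_interior cs.
pose D s := z1 s * (r s - p0.1) - r1 s * (z s - p0.2).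
have [cr cz cr1 cz1] := curve_continuous.
have cD : continuous D.
  by apply: cts_sub; apply: cts_mul => //; apply: cts_sub => //; exact: cts_cst.
have sD s : exists e : R, [/\ e * e = 1, 0 < e * D s,
    (n (c s)).1 = e * z1 s & (n (c s)).2 = - e * r1 s].
  have [e [ee n1 n2]] := normal_rotated s; exists e; split=> //.
  by have := normal_support_lt s Ep0; rewrite n1 n2 /D; lra.
have D0 s : D s != 0.
  by apply/eqP => h; have [e []] := sD s; rewrite h mulr0 ltxx.
have sq1 (e : R) : e * e = 1 -> e = 1 \/ e = -1.
  move=> h; have /eqP : (e - 1) * (e + 1) = 0 by lra.
  by rewrite mulf_eq0 subr_eq0 addr_eq0 => /orP[]/eqP; [left|right].
have [hD|hD] := nonvanishing_sign cD D0; [exists 1|exists (-1)].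
  have h s : (n (c s)).1 = 1 * z1 s /\ (n (c s)).2 = - 1 * r1 s.
    have [e [/sq1[->|->] + -> ->]] := sD s => //; have := hD s; lra.
  by split; [ring|move=> s; case: (h s)..].
have h s : (n (c s)).1 = -1 * z1 s /\ (n (c s)).2 = - -1 * r1 s.
  have [e [/sq1[->|->] + -> ->]] := sD s => //; have := hD s; lra.
by split; [ring|move=> s; case: (h s)..].
Qed.

(** By the support inequality, [t => n (c s) . c t] is maximal at [t = s], and its second derivative
    there is minus the curvature. *)
Lemma curvature_ge0 s : 0 <= curvature c n s.
Proof.
have [e [ee n1 n2]] := normal_oriented.
have -> : curvature c n s = - ((n (c s)).1 * r2 s + (n (c s)).2 * z2 s).
  by congr (- (_ + _)); exact: mulrC.
rewrite oppr_ge0.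
apply: (@second_derivative_max_le0 _
  (fun t => (n (c s)).1 * r t + (n (c s)).2 * z t)
  (fun t => (n (c s)).1 * r1 t + (n (c s)).2 * z1 t) s
  ((n (c s)).1 * r2 s + (n (c s)).2 * z2 s)).
- move=> t; have [dr dz _ _] := curve_deriv t.
  by apply: is_deriv_add; apply: is_deriv_scale.
- have [_ _ dr dz] := curve_deriv s.
  by apply: is_deriv_add; apply: is_deriv_scale.
- by rewrite n1 n2; ring.
- by move=> t; have h := @normal_support s (c t) (@curve_closure t); rewrite -subr_le0 (le_trans _ h)// le_eqVlt; apply/orP; left; apply/eqP; rewrite /r /z; ring.
Qed.

End cross_section_geometry.

(** * The two arcs of the boundary *)

Lemma itv_nonvanishing_pos (R : realType) (f : R -> R) (a b x0 : R) :
  continuous f -> (forall x, a < x < b -> f x != 0) -> a < x0 < b ->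
  0 < f x0 -> forall x, a < x < b -> 0 < f x.
Proof.
move=> cf f0 /andP[ax0 x0b] h0 x /andP[ax xb]; rewrite ltNge; apply/negP => hx.
have [xx|xx] := leP x x0.
  have [|y] := IVT (v := 0) xx (continuous_subspaceT cf).
    by rewrite ge_min le_max hx (ltW h0) orbT.
  rewrite in_itv /= => /andP[y1 y2] /eqP; apply/negP/f0.
  by rewrite (lt_le_trans ax y1) (le_lt_trans y2 x0b).
have [|y] := IVT (v := 0) (ltW xx) (continuous_subspaceT cf).
  by rewrite ge_min le_max hx (ltW h0) orbT.
rewrite in_itv /= => /andP[y1 y2] /eqP; apply/negP/f0.
by rewrite (lt_le_trans ax0 y1) (le_lt_trans y2 xb).
Qed.

Lemma periodic_intmul (R : realType) (T : Type) (f : R -> T) (L : R) (k : int) s :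
  (forall s, f (s + L) = f s) -> f (s + k%:~R * L) = f s.
Proof.
move=> per; have pn (m : nat) t : f (t + m%:R * L) = f t.
  elim: m t => [|m IH] t; first by rewrite mul0r addr0.
  by rewrite -natr1 mulrDl mul1r addrA per IH.
case: k => m; first exact: pn.
by rewrite NegzE mulrNz mulNr -[LHS](pn m.+1) subrK.
Qed.

Lemma periodic_reduction (R : realType) (L a s : R) : 0 < L ->
  exists k : int, a <= s - k%:~R * L < a + L.
Proof.
move=> L0; exists (Num.floor ((s - a) / L)).
have h1 := Num.Theory.floor_le ((s - a) / L).
have h2 := Num.Theory.floorD1_gt ((s - a) / L).
rewrite ler_pdivlMr// in h1; rewrite ltr_pdivrMr// intrD mulrDl mul1r in h2.
by apply/andP; split; lra.
Qed.

Section arcs.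
Context {R : realType} (E : set (plane R)) (c : R -> plane R) (L : R).
Context (n : plane R -> plane R).
Hypothesis cs : cross_section E c L.
Hypothesis on : outer_unit_normal E c n.

Let r (s : R) : R := (c s).1.
Let z (s : R) : R := (c s).2.
Let r1 (s : R) : R := (derive1 c s).1.
Let z1 (s : R) : R := (derive1 c s).2.

Lemma curve_periodic s : c (s + L) = c s.
Proof. exact: c2b_periodic (cs_C2 cs) s. Qed.

Lemma curve_reduce a s : exists2 t : R, a <= t < a + L & c t = c s.
Proof.
have [k hk] := periodic_reduction a s (c2b_length (cs_C2 cs)).
exists (s - k%:~R * L) => //.
by rewrite -[RHS](periodic_intmul (- k) s curve_periodic) mulrNz mulNr.
Qed.

Lemma curve_injective a s t : a <= s < a + L -> a <= t < a + L ->
  c s = c t -> s = t.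
Proof.
move=> /andP[as1 as2] /andP[at1 at2] st; have L0 := c2b_length (cs_C2 cs).
have [k /andP[k1 k2]] := periodic_reduction 0 s L0.
have [l /andP[l1 l2]] := periodic_reduction 0 t L0.
rewrite add0r in k2 l2.
have := @c2b_simple _ _ _ _ (cs_C2 cs) (s - k%:~R * L) (t - l%:~R * L).
rewrite !in_itv /= k1 k2 l1 l2 => /(_ isT isT).
have redc m w : c (w - m%:~R * L) = c w.
  by rewrite -[RHS](periodic_intmul (- m) w curve_periodic) mulrNz mulNr.
rewrite !redc => /(_ st) h.
have {}h : s - t = (k - l)%:~R * L by rewrite intrB mulrBl; lra.
suff kl : k - l = 0 by move: h; rewrite kl mul0r => /eqP; rewrite subr_eq0 => /eqP.
have b1 : (k - l)%:~R * L < L by lra.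
have b2 : - L < (k - l)%:~R * L by lra.
have {}b1 : (k - l)%:~R < 1 :> R by rewrite -(ltr_pM2r L0) mul1r.
have {}b2 : -1 < (k - l)%:~R :> R by rewrite -(ltr_pM2r L0) mulN1r.
move: b1 b2; rewrite -[1]/(1%:~R) -mulrNz !ltr_int; lia.
Qed.

(** A maximum of the linear form along the curve exists by compactness of one period. There the
    tangent is orthogonal to [(a, b)], so [(a, b)] is [mu] times a unit normal, and the supporting
    line shows that the maximum is one over [closure E], provided [e * mu >= 0]. *)
Lemma curve_max a b : exists s, (forall x, closure E x ->
  a * x.1 + b * x.2 <= a * r s + b * z s) /\ a * r1 s + b * z1 s = 0.
Proof.
have L0 := c2b_length (cs_C2 cs).
pose f s := a * r s + b * z s.
have [cr cz cr1 cz1] := curve_continuous cs.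
have df (s : R) : is_derive s 1 (f : R -> R) (a * r1 s + b * z1 s).
  have [dr dz _ _] := curve_deriv cs s.
  by apply: is_deriv_add; apply: is_deriv_scale.
have cf : {within `[0, L], continuous f}.
  by apply: continuous_subspaceT => s; exact: is_derive1_continuous (df s).
have [s0 _ hs0] := EVT_max (ltW L0) cf.
have fmax s : f s <= f s0.
  have [t /andP[t0 tL] ct] := curve_reduce 0 s; rewrite add0r in tL.
  have -> : f s = f t by rewrite /f /r /z ct.
  by apply: hs0; rewrite in_itv /= t0 ltW.
have f10 s : (forall t, f t <= f s) -> a * r1 s + b * z1 s = 0.
  move=> hm; have hd : forall t : R, t \in `]s - 1, s + 1[ -> derivable f t 1.
    by move=> t _; case: (df t).
  have h1 : s - 1 <= s + 1 by lra.
  have h2 : s \in `]s - 1, s + 1[ by rewrite in_itv /=; apply/andP; split; lra.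
  have [_ h] := derive1_at_max h1 hd h2 (fun t _ => hm t).
  by rewrite -[LHS](@derive_val _ _ _ _ _ _ _ (df s)) h.
have f1s0 := f10 s0 fmax.
exists s0; split=> // x Ex; rewrite -/(f s0).
have [e [ee n1 n2]] := normal_oriented cs on.
have u := curve_unit cs s0.
have sup y : closure E y -> e * (z1 s0 * (y.1 - r s0) - r1 s0 * (y.2 - z s0)) <= 0.
  move=> Ey; have h := @normal_support _ _ _ _ _ cs on s0 y Ey.
  by rewrite n1 n2 in h; apply: le_trans h; rewrite le_eqVlt; apply/orP; left; apply/eqP; rewrite /r1 /z1 /r /z; ring.
pose mu := a * z1 s0 - b * r1 s0.
have key y : f s0 - (a * y.1 + b * y.2) =
    - ((e * mu) * (e * (z1 s0 * (y.1 - r s0) - r1 s0 * (y.2 - z s0)))).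
  have ea : a = mu * z1 s0.
    rewrite -[LHS]mulr1 -u /mu; move/(congr1 (fun x => x * r1 s0)): f1s0.
    by rewrite /r1 /z1; lra.
  have eb : b = - (mu * r1 s0).
    rewrite -[LHS]mulr1 -u /mu; move/(congr1 (fun x => x * z1 s0)): f1s0.
    by rewrite /r1 /z1; lra.
  rewrite mulrACA ee /f {1 2}ea {1 2}eb; ring.
have [mu0|mu0] := leP 0 (e * mu).
  by rewrite -subr_ge0 key -mulrN mulr_ge0// oppr_ge0; exact: sup.
(* If [e * mu < 0], the supporting line makes [c s0] a minimum as well, so the form is constant on
   the curve. *)
have fconst s : f s = f s0.
  apply/le_anti; rewrite fmax /= -subr_le0 (key (c s)) -mulNr.
  rewrite mulr_ge0_le0// ?oppr_ge0 ?(ltW mu0)//.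
  exact: (@sup (c s) (@curve_closure _ _ _ _ cs s)).
have f1c s : a * r1 s + b * z1 s = 0.
  by apply: f10 => t; rewrite !fconst.
have dg (s : R) : is_derive s 1 (fun s => a * z s - b * r s) (a * z1 s - b * r1 s).
  have [dr dz _ _] := curve_deriv cs s.
  by apply: is_deriv_sub; apply: is_deriv_scale.
(* The orthogonal form [a * z - b * r] is periodic and has a critical point [s']. Both forms are
   then stationary against the unit tangent at [s'], which forces [a = b = 0], contrary to
   [e * mu < 0]. *)
have [s' _ h'] : exists2 s' : R, s' \in `]0, L[ & (a * z L - b * r L) -
    (a * z 0 - b * r 0) = (a * z1 s' - b * r1 s') * (L - 0).
  apply: (@MVT _ (fun s => a * z s - b * r s)) => //.
  by apply: continuous_subspaceT => s; exact: is_derive1_continuous (dg s).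
have : a * z1 s' - b * r1 s' = 0.
  have e0 : c L = c 0 by rewrite -[L]add0r curve_periodic.
  move: h'; rewrite /z /r e0 subrr subr0 => /esym/eqP.
  by rewrite mulf_eq0 (gt_eqF L0) orbF => /eqP.
have := f1c s'; have := curve_unit cs s'; rewrite -/(r1 s') -/(z1 s').
move: mu0; rewrite /mu; move: (r1 s') (z1 s') => p q mu0 upq e1 e2.
have ea : a = 0.
  have : a = p * (a * p + b * q) + q * (a * q - b * p) by rewrite -[LHS]mulr1 -upq; ring.
  by rewrite e1 e2 !mulr0 addr0.
have eb : b = 0.
  have : b = q * (a * p + b * q) - p * (a * q - b * p) by rewrite -[LHS]mulr1 -upq; ring.
  by rewrite e1 e2 !mulr0 subr0.
by move: mu0; rewrite ea eb !mul0r subrr mulr0 ltxx.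
Qed.

Lemma closure_mirror x y : closure E (x, y) -> closure E (x, - y).
Proof.
move=> /closure_boxP h; apply/closure_boxP => e e0.
have [[q1 q2] [Eq /= h1 h2]] := h e e0; exists (q1, - q2); split => //=.
  exact: (cs_symmetric cs q1 q2).1.
by rewrite (_ : - q2 - - y = - (q2 - y)) ?normrN//; ring.
Qed.

Lemma interior_mirror x y : E° (x, y) -> E° (x, - y).
Proof.
move=> /nbhs_boxP[e [e0 h]]; apply/nbhs_boxP; exists e; split=> // -[q1 q2] /= h1 h2.
have := (cs_symmetric cs q1 (- q2)).1; rewrite opprK; apply; apply: h => //=.
by rewrite (_ : - q2 - y = - (q2 - - y)) ?normrN//; ring.
Qed.

(* [(rt, zm)] and [(rt, - zm)] are the top and bottom points of [E], joined by the
   right arc [u, v] and the left arc [v, u + L]; the sign [e] is the orientation: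
   [n_r = e * z1]. *)
Definition arcs_spec (e u v rt zm rmin rmax : R) : Prop :=
  [/\ [/\ e * e = 1, u < v, v < u + L & 0 < zm],
  [/\ 0 < rmin, rmin < rt, rt < rmax, closure E (rmin, 0) & closure E (rmax, 0)],
  [/\ forall x, closure E x -> rmin <= x.1 /\ x.1 <= rmax,
     forall x, closure E x -> `|x.2| <= zm,
     closure E (rt, zm), closure E (rt, - zm) &
     forall y, `|y| < zm -> E° (rt, y)],
  [/\ r u = rt, r v = rt, e * z u = - zm & e * z v = zm] &
  [/\ forall s, u < s < v -> rt < r s, forall s, v < s < u + L -> r s < rt,
    forall s, u < s < v -> 0 <= e * z1 s,
    forall s, v < s < u + L -> e * z1 s <= 0 & forall s, closure E (rt, z s)]].

(** The open vertical chord below a topmost point [c s0] is interior to [E], so the curve meets the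
    line [r = rt] only at the two ends of the chord. Hence [r - rt] has constant sign on each of the
    two arcs between these ends, and the horizontal tangent at the top shows that the signs are
    opposite. *)
Lemma arcs : exists e u v rt zm rmin rmax : R,
  [/\ forall s, (n (c s)).1 = e * z1 s, forall s, (n (c s)).2 = - e * r1 s &
  arcs_spec e u v rt zm rmin rmax].
Proof.
have [e [ee n1 n2]] := normal_oriented cs on.
have L0 := c2b_length (cs_C2 cs).
have [cr cz cr1 cz1] := curve_continuous cs.
have cc s : closure E (c s) := @curve_closure _ _ _ _ cs s.
have cE := cs_convex cs.
have surj p : boundary E p -> exists s, c s = p.
  by rewrite -(c2b_range (cs_C2 cs)) => -[s _ <-]; exists s.
have [s0 [top t0]] := curve_max 0 1.
pose rt := r s0; pose zm := z s0.
have {}top x : closure E x -> x.2 <= zm by move=> /top; rewrite !mul0r !add0r !mul1r.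
have {}t0 : z1 s0 = 0 by move: t0; rewrite mul0r add0r mul1r.
have topn x : closure E x -> `|x.2| <= zm.
  case: x => x y h; rewrite ler_norml (top _ h) andbT lerNl.
  exact: (top _ (closure_mirror h)).
have [p Ep] := cs_interior cs.
have zm0 : 0 < zm.
  have /nbhs_boxP[d [d0 hd]] := Ep.
  have h1 := topn p (interior_closure Ep).
  have h2 : closure E (p.1, p.2 + d / 2).
    apply/subset_closure/hd => /=; first by rewrite subrr normr0.
    by rewrite addrAC subrr add0r gtr0_norm; lra.
  have h3 : closure E (p.1, p.2 - d / 2).
    apply/subset_closure/hd => /=; first by rewrite subrr normr0.
    by rewrite addrAC subrr add0r normrN gtr0_norm; lra.
  have := topn _ h2; have := topn _ h3; rewrite /= !ler_norml.
  by move=> /andP[? ?] /andP[? ?]; lra.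
have Pt : closure E (rt, zm) by rewrite (_ : (rt, zm) = c s0) // /rt /zm /r /z -surjective_pairing.
have Pb : closure E (rt, - zm) := closure_mirror Pt.
have [sb hsb] : exists s, c s = (rt, - zm).
  apply: surj; split=> // /nbhs_boxP[d [d0 hd]].
  have h2 : closure E (rt, - zm - d / 2).
    apply/subset_closure/hd => /=; first by rewrite subrr normr0.
    by rewrite addrAC subrr add0r normrN gtr0_norm; lra.
  by have := topn _ h2; rewrite /= ler_norml => /andP[? ?]; lra.
have [s1 /andP[s01 s1L] cs1] := curve_reduce s0 sb; rewrite hsb in cs1.
have {}s01 : s0 < s1.
  rewrite lt_neqAle s01 andbT; apply/eqP => h.
  have : z s1 = - zm by rewrite /z cs1.
  by rewrite -h -/zm; lra.
have r1s0 : r1 s0 * r1 s0 = 1 by have := curve_unit cs s0; rewrite -/(r1 s0) -/(z1 s0) t0 mul0r addr0.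
(* At the top [z1 = 0], so [r1] is [1] or [-1] there and the curve crosses the line [r = rt]. *)
have [d d0 hd] : exists2 d : R, 0 < d & forall h, 0 < h -> h < d ->
    0 < r1 s0 * (r (s0 + h) - rt) /\ r1 s0 * (r (s0 - h) - rt) < 0.
  have [dr _ _ _] := curve_deriv cs s0.
  have e2 : (0 : R) < 2^-1 by rewrite invr_gt0.
  have [d d0 hd] := is_derive_approx dr e2; exists d => // h h0 hlt.
  have [b1 _] := curve_deriv_norm_le cs s0.
  have k1 := hd h; rewrite gtr0_norm// in k1; have {}k1 := k1 hlt.
  have k2 := hd (- h); rewrite normrN gtr0_norm// in k2; have {}k2 := k2 hlt.
  move: k1 k2 b1 r1s0; rewrite -/(r s0) -/(r (s0 + h)) -/(r (s0 - h)) -/(r1 s0) -/rt.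
  move: (r (s0 + h)) (r (s0 - h)) (r1 s0) => x y w k1 k2 b1 ww.
  have w1 : `|w| = 1 by apply/eqP; rewrite -(@eqrXn2 _ 2)// expr1n -normrX expr2 ww normr1.
  have k1' : `|w * (x - rt - h * w)| <= 2^-1 * h by rewrite normrM w1 mul1r.
  have k2' : `|w * (y - rt - - h * w)| <= 2^-1 * h by rewrite normrM w1 mul1r.
  move: k1' k2'; rewrite !ler_norml => /andP[k3 _] /andP[_ k4].
  have e3 : w * (x - rt - h * w) = w * (x - rt) - h * (w * w) by ring.
  have e4 : w * (y - rt - - h * w) = w * (y - rt) + h * (w * w) by ring.
  by rewrite e3 ww in k3; rewrite e4 ww in k4; split; lra.
have left_right : (exists2 x, closure E x & x.1 < rt) /\ (exists2 x, closure E x & rt < x.1).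
  have d2 : 0 < d / 2 by lra.
  have d2' : d / 2 < d by lra.
  have [h1 h2] := hd _ d2 d2'.
  have [w0|w0] := leP 0 (r1 s0).
    split; [exists (c (s0 - d / 2))|exists (c (s0 + d / 2))] => //.
      by rewrite -/(r (s0 - d / 2)); move: h2; rewrite pmulr_rlt0 ?subr_lt0// lt_neqAle w0 andbT; apply/eqP => h; move: r1s0; rewrite -h; lra.
    by rewrite -/(r (s0 + d / 2)); move: h1; rewrite pmulr_rgt0 ?subr_gt0// lt_neqAle w0 andbT; apply/eqP => h; move: r1s0; rewrite -h; lra.
  split; [exists (c (s0 + d / 2))|exists (c (s0 - d / 2))] => //.
    by rewrite -/(r (s0 + d / 2)); move: h1; rewrite nmulr_rgt0// subr_lt0.
  by rewrite -/(r (s0 - d / 2)); move: h2; rewrite nmulr_rlt0// subr_gt0.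
have mid x : closure E x -> closure E (x.1, 0).
  case: x => x y h; apply: (@convex_closure _ E (x, y) (x, - y) _ (2^-1)) => //=; try lra.
  exact: closure_mirror.
(* By symmetry some point [(p.1, 0)] is interior. Since the closure has points on both sides of the
   chord line, [(rt, 0)], if different, lies strictly between [(p.1, 0)] and an axis point of the
   closure beyond the chord. *)
have p0 : E° (rt, 0).
  have pp : E° (p.1, 0).
    apply: (@convex_interior _ E p (p.1, - p.2) _ (2^-1)) => //=; try lra.
    by apply: closure_mirror; rewrite -surjective_pairing; exact: interior_closure.
  have [[xl cl ll] [xr cr' lr]] := left_right.
  have [h|h|<-//] := ltgtP p.1 rt.
    apply: (@convex_interior _ E (p.1, 0) (xr.1, 0) _ ((rt - p.1) / (xr.1 - p.1))) => //=.
    - by rewrite divr_ge0; lra.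
    - by rewrite ltr_pdivrMr; lra.
    - exact: mid.
    - by field; lra.
    - by rewrite !mulr0 addr0.
  apply: (@convex_interior _ E (p.1, 0) (xl.1, 0) _ ((p.1 - rt) / (p.1 - xl.1))) => //=.
  - by rewrite divr_ge0; lra.
  - by rewrite ltr_pdivrMr; lra.
  - exact: mid.
  - by field; lra.
  - by rewrite !mulr0 addr0.
have chord y : `|y| < zm -> E° (rt, y).
  move=> hy; have [y0|y0] := leP 0 y.
    rewrite ger0_norm// in hy.
    apply: (@convex_interior _ E (rt, 0) (rt, zm) _ (y / zm)) => //=.
    - by rewrite divr_ge0// ltW.
    - by rewrite ltr_pdivrMr; lra.
    - by ring.
    - by field; lra.
  rewrite ltr0_norm// in hy.
  apply: (@convex_interior _ E (rt, 0) (rt, - zm) _ (- y / zm)) => //=.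
  - by rewrite divr_ge0//; lra.
  - by rewrite ltr_pdivrMr; lra.
  - by ring.
  - by field; lra.
have vert s : r s = rt -> c s = c s0 \/ c s = c s1.
  move=> hr; have hz := topn _ (cc s).
  have [lt|] := ltP `|(c s).2| zm.
    have := curve_boundary cs s; rewrite [c s]surjective_pairing -/(r s) hr => -[_]; case.
    exact: chord.
  move=> ge; have {ge}hz : `|(c s).2| = zm by apply/le_anti; rewrite hz.
  have [y0|y0] := leP 0 (c s).2; [left|right].
    rewrite [c s]surjective_pairing [c s0]surjective_pairing; congr (_, _) => //.
    have ez : (c s).2 = zm by rewrite -hz ger0_norm.
    exact: ez.
  rewrite cs1 [c s]surjective_pairing; congr (_, _) => //.
  have ez : (c s).2 = - zm by rewrite -hz ltr0_norm// opprK.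
  exact: ez.
have rp s : r (s + L) = r s by rewrite /r curve_periodic.
have nz s : s0 < s < s1 \/ s1 < s < s0 + L -> r s - rt != 0.
  move=> hs; rewrite subr_eq0; apply/eqP => /vert.
  have sb1 : s0 <= s < s0 + L by case: hs => /andP[? ?]; apply/andP; split; lra.
  have sb2 : s0 <= s0 < s0 + L by apply/andP; split; lra.
  have sb3 : s0 <= s1 < s0 + L by apply/andP; split; lra.
  by case=> /(curve_injective sb1) h; move: hs; rewrite h ?ltxx ?andbF => // -[]//; rewrite ltNge ltW.
have cf k : continuous (fun s => k * (r s - rt)).
  by apply: cts_mul; [exact: cts_cst|apply: cts_sub => //; exact: cts_cst].
have w0 : r1 s0 != 0 by apply/eqP => h; move: r1s0; rewrite h mul0r; lra.
have sgn1 s : s0 < s < s1 -> 0 < r1 s0 * (r s - rt).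
  pose h := Num.min (d / 2) ((s1 - s0) / 2).
  have h0 : 0 < h by rewrite lt_min; apply/andP; split; lra.
  have [h1 h2] : h <= d / 2 /\ h <= (s1 - s0) / 2 by rewrite !ge_min !lexx orbT.
  apply: (@itv_nonvanishing_pos _ (fun s => r1 s0 * (r s - rt)) s0 s1 (s0 + h)) => //.
  - by move=> x hx; rewrite mulf_neq0//; apply: nz; left.
  - by apply/andP; split; lra.
  - by case: (hd h h0) => //; lra.
have sgn2 s : s1 < s < s0 + L -> 0 < - r1 s0 * (r s - rt).
  pose h := Num.min (d / 2) ((s0 + L - s1) / 2).
  have h0 : 0 < h by rewrite lt_min; apply/andP; split; lra.
  have [h1 h2] : h <= d / 2 /\ h <= (s0 + L - s1) / 2 by rewrite !ge_min !lexx orbT.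
  apply: (@itv_nonvanishing_pos _ (fun s => - r1 s0 * (r s - rt)) s1 (s0 + L) (s0 + L - h)) => //.
  - by move=> x hx; rewrite mulf_neq0// ?oppr_eq0//; apply: nz; right.
  - by apply/andP; split; lra.
  - have -> : r (s0 + L - h) = r (s0 - h) by rewrite -[RHS]rp addrAC.
    by rewrite mulNr oppr_gt0; case: (hd h h0) => //; lra.
have [sR [topR _]] := curve_max 1 0.
have [sL [topL _]] := curve_max (-1) 0.
pose rmax := r sR; pose rmin := r sL.
have hmax x : closure E x -> x.1 <= rmax by move=> /topR; rewrite !mul0r !addr0 !mul1r.
have hmin x : closure E x -> rmin <= x.1 by move=> /topL; rewrite !mul0r !addr0 !mulN1r lerN2.
have slice s : closure E (rt, z s).
  have := topn _ (cc s); rewrite -/(z s) ler_norml => /andP[? ?].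
  apply: (@convex_closure _ E (rt, zm) (rt, - zm) _ ((zm - z s) / (2 * zm))) => //=.
  - by rewrite divr_ge0; lra.
  - by rewrite ler_pdivrMr; lra.
  - by ring.
  - by field; lra.
(* Testing the support inequality with the chord point at the height of [c s] isolates the radial
   component of the normal. *)
have sgn s : e * z1 s * (rt - r s) <= 0.
  have := @normal_support _ _ _ _ _ cs on s _ (slice s); rewrite n1 /=.
  by rewrite subrr mulr0 addr0.
have sgnr s : rt < r s -> 0 <= e * z1 s.
  by move=> h; rewrite -(@nmulr_lle0 _ (rt - r s)) ?sgn// subr_lt0.
have sgnl s : r s < rt -> e * z1 s <= 0.
  by move=> h; rewrite -(@pmulr_lle0 _ (rt - r s)) ?subr_gt0// mulrC sgn.
have sq1 (a : R) : a * a = 1 -> a = 1 \/ a = -1.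
  move=> h; have /eqP : (a - 1) * (a + 1) = 0 by lra.
  by rewrite mulf_eq0 subr_eq0 addr_eq0 => /orP[]/eqP; [left|right].
suff : exists u v, [/\ u < v, v < u + L, r u = rt, r v = rt &
    [/\ (z u = zm /\ z v = - zm) \/ (z u = - zm /\ z v = zm),
      forall s, u < s < v -> rt < r s & forall s, v < s < u + L -> r s < rt]].
  move=> [u [v [uv vu ru rv [zuv right_arc left_arc]]]].
  exists e, u, v, rt, zm, rmin, rmax; split => //; split => //.
  - have [[xl cl ll] [xr cr' lr]] := left_right.
    split; last exact: (mid _ (cc sR)).
    + exact: (cs_half_plane cs (cc sL)).
    + exact: le_lt_trans (hmin _ cl) ll.
    + exact: lt_le_trans lr (hmax _ cr').
    + exact: (mid _ (cc sL)).
  - by split=> // x Ex; split; [exact: hmin|exact: hmax].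
  (* The sign of [n_r] makes [e * z] nondecreasing along the right arc; this decides, for either
     orientation, which end carries [- zm]. *)
  - have mono : e * z u <= e * z v.
      apply: (@ge0_deriv_le _ (fun s => e * z s) (fun s => e * z1 s)); first exact: ltW.
        move=> s _; have [_ dz _ _] := curve_deriv cs s; exact: is_deriv_scale.
      by move=> s /right_arc; exact: sgnr.
    case: (sq1 _ ee) mono => ->; rewrite ?mul1r ?mulN1r ?lerN2.
      by case: zuv => -[-> ->]; split=> //; lra.
    by case: zuv => -[-> ->]; rewrite ?opprK; split=> //; lra.
  - by split=> // s => [/right_arc|/left_arc]; [exact: sgnr|exact: sgnl].
have zs1 : z s1 = - zm by rewrite /z cs1.
have rs1 : r s1 = rt by rewrite /r cs1.
(* If the curve leaves the top to the right, the right arc starts at the top [s0]; otherwise it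
   starts at the bottom [s1] and ends at the top, reached again at [s0 + L]. *)
case: (sq1 _ r1s0) => hw; rewrite hw in sgn1 sgn2.
  exists s0, s1; split=> //; split; first by left.
    by move=> s /sgn1; rewrite mul1r subr_gt0.
  by move=> s /sgn2; rewrite mulN1r oppr_gt0 subr_lt0.
exists s1, (s0 + L); split=> //; first by lra.
split; first by right; split=> //; rewrite /z curve_periodic.
  by move=> s /sgn2; rewrite opprK mul1r subr_gt0.
move=> s /andP[h1 h2]; rewrite -[s](subrK L) rp.
have : s0 < s - L < s1 by apply/andP; split; lra.
by move=> /sgn1; rewrite mulN1r oppr_gt0 subr_lt0.
Qed.

End arcs.

(** * Total curvature and perimeter *)

(** This is needed because the angle [atan (z / (r - a))] is usable only inside an arc: at the ends
    [r = a]. *)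
Lemma increment_le_of_interior (R : realType) (G : R -> R) (u v k : R) :
  u < v -> continuous G ->
  (forall x y, u < x -> x < y -> y < v -> G y - G x <= k) -> G v - G u <= k.
Proof.
move=> uv cG h; rewrite leNgt; apply/negP => hk.
pose phi := fun x => G (v - x) - G (u + x).
have c1 : continuous (fun x : R => v - x).
  by apply: cts_sub; [exact: cts_cst|move=> x; exact: cvg_id].
have c2 : continuous (fun x : R => u + x).
  by apply: cts_add; [exact: cts_cst|move=> x; exact: cvg_id].
have cphi : continuous phi.
  by apply: cts_sub => x; apply: continuous_comp; [exact: c1|exact: cG|exact: c2|exact: cG].
have near_gt : \forall x \near (0 : R), k < phi x.
  have : \forall y \near phi 0, k < y by apply: lt_nbhsr; rewrite /phi subr0 addr0.
  exact: cphi.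
have [d d0 hd] : exists2 d : R, 0 < d & forall x, `|x| < d -> k < phi x.
  have /nbhs_ballP[d d0 hd] := near_gt; exists d => // x hx; apply: hd.
  by rewrite -ball_normE /= sub0r normrN.
pose x := Num.min (d / 2) ((v - u) / 4).
have x0 : 0 < x by rewrite lt_min; apply/andP; split; lra.
have [x1 x2] : x <= d / 2 /\ x <= (v - u) / 4 by rewrite !ge_min !lexx orbT.
have hx : phi x <= k by apply: h; lra.
have xd : `|x| < d by rewrite gtr0_norm//; lra.
by have := hd x xd; rewrite ltNge hx.
Qed.

Section closed_curve.
Context {R : realType} (r z r1 z1 r2 z2 kap K : R -> R) (e a L u v : R).
Hypothesis dr : forall s : R, is_derive s 1 r (r1 s).
Hypothesis dz : forall s : R, is_derive s 1 z (z1 s).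
Hypothesis dr1 : forall s : R, is_derive s 1 r1 (r2 s).
Hypothesis dz1 : forall s : R, is_derive s 1 z1 (z2 s).
Hypothesis unit : forall s, r1 s * r1 s + z1 s * z1 s = 1.
Hypothesis pr : forall s, r (s + L) = r s.
Hypothesis pz : forall s, z (s + L) = z s.
Hypothesis pr1 : forall s, r1 (s + L) = r1 s.
Hypothesis pz1 : forall s, z1 (s + L) = z1 s.
Hypothesis ee : e * e = 1.
Hypothesis kapE : forall s, kap s = e * (r1 s * z2 s - z1 s * r2 s).
Hypothesis dK : forall s : R, is_derive s 1 K (kap s).

(** [D] and [N] are the determinant and the scalar product of the position vector from [(a, 0)] with
    the unit tangent; [e * D] is the support function with respect to that point. *)
Let D s := (r s - a) * z1 s - z s * r1 s.
Let N s := (r s - a) * r1 s + z s * z1 s.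
Hypothesis D0 : forall s, 0 < e * D s.
Hypothesis uv : u < v.
Hypothesis vu : v < u + L.

Lemma frenet s : r2 s = - (kap s * e * z1 s) /\ z2 s = kap s * e * r1 s.
Proof.
have h : r1 s * r2 s + z1 s * z2 s = 0.
  have d1 := is_deriv_add (is_deriv_mul (dr1 s) (dr1 s)) (is_deriv_mul (dz1 s) (dz1 s)).
  have [_ d2] := d1; have [_ d3] : is_derive s 1 (cst (1 : R) : R -> R) 0 by apply: is_derive_cst.
  have e1 : (fun y => r1 y * r1 y + z1 y * z1 y) = cst 1 by apply/funext => y; rewrite unit.
  by rewrite e1 d3 in d2; lra.
have ke : kap s * e = r1 s * z2 s - z1 s * r2 s.
  by rewrite kapE mulrAC ee mul1r.
rewrite !ke; split.
  have : r2 s = - ((r1 s * z2 s - z1 s * r2 s) * z1 s) + r1 s * (r1 s * r2 s + z1 s * z2 s).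
    by rewrite -[LHS]mulr1 -(unit s); ring.
  by rewrite h mulr0 addr0.
have : z2 s = (r1 s * z2 s - z1 s * r2 s) * r1 s + z1 s * (r1 s * r2 s + z1 s * z2 s).
  by rewrite -[LHS]mulr1 -(unit s); ring.
by rewrite h mulr0 addr0.
Qed.

Lemma deriv_ra (s : R) : is_derive s 1 (fun t => r t - a) (r1 s).
Proof. by rewrite -[r1 s]subr0; apply: is_deriv_sub. Qed.

Lemma deriv_N (s : R) : is_derive s 1 N (1 - kap s * (e * D s)).
Proof.
have [f1 f2] := frenet s.
apply: (is_derive_eq (is_deriv_add (is_deriv_mul (deriv_ra s) (dr1 s))
  (is_deriv_mul (dz s) (dz1 s)))).
by rewrite f1 f2 -[in RHS](unit s) /D; ring.
Qed.

Lemma deriv_D (s : R) : is_derive s 1 D (kap s * (e * N s)).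
Proof.
have [f1 f2] := frenet s.
apply: (is_derive_eq (is_deriv_sub (is_deriv_mul (deriv_ra s) (dz1 s))
  (is_deriv_mul (dz s) (dr1 s)))).
by rewrite f1 f2 /N; ring.
Qed.

Lemma D_neq0 s : D s != 0.
Proof. by apply/eqP => h; have := D0 s; rewrite h mulr0 ltxx. Qed.

Let W s := (r s - a) * (r s - a) + z s * z s.

Lemma NDW s : N s * N s + D s * D s = W s.
Proof.
rewrite -[RHS]mulr1 -(unit s) /N /D /W; ring.
Qed.

Lemma W_neq0 s : W s != 0.
Proof.
apply/eqP => h; have := NDW s; rewrite h => h'.
have : 0 < D s * D s by rewrite -expr2 exprn_even_gt0//= D_neq0.
have : 0 <= N s * N s by rewrite -expr2 sqr_ge0.
lra.
Qed.

(* [G] differs from the primitive [K] of the curvature by a periodic function,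
   the angle between the tangent and the position vector based at [(a, 0)]; on
   arcs that avoid the line [r = a] it is the polar angle up to a constant. *)
Let G s := K s + e * atan (N s / D s).

(** The terms in [kap] cancel, and what remains is [e] times the derivative of the polar angle about
    [(a, 0)]. *)
Lemma deriv_G (s : R) : is_derive s 1 G (e * D s / W s).
Proof.
have d1 := is_deriv_div (D_neq0 s) (deriv_N s) (deriv_D s).
have d2 := is_deriv_comp d1 (is_derive1_atan _).
apply: (is_derive_eq (is_deriv_add (dK s) (is_deriv_scale e d2))).
have W0 := W_neq0 s; have DD := D_neq0 s; have nd := NDW s.
have nd' : D s ^+ 2 + N s ^+ 2 != 0 by rewrite addrC !expr2 nd.
have -> : W s = D s ^+ 2 + N s ^+ 2 by rewrite -nd !expr2 addrC.
rewrite [X in X + _](_ : _ = e * (kap s * e)); last by rewrite [e * _]mulrC -mulrA ee mulr1.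
rewrite (mulrA (kap s) e (D s)) (mulrA (kap s) e (N s)).
by field; apply/andP.
Qed.

Lemma cts_G : continuous G.
Proof. by move=> s; exact: is_derive1_continuous (deriv_G s). Qed.

(** Inside the arc, [e * atan (z / (r - a))] has the same derivative as [G], and [atan] takes its
    values in an interval of length [pi]. *)
Lemma arc_angle_le (x0 y0 : R) : x0 < y0 ->
  (forall s, x0 < s < y0 -> r s - a != 0) -> G y0 - G x0 <= pi.
Proof.
move=> xy0 hne; apply: increment_le_of_interior => //; first exact: cts_G.
move=> x y xx xy yy.
have -> : G y - G x = e * atan (z y / (r y - a)) - e * atan (z x / (r x - a)).
  apply: (@deriv_eq _ _ (fun s => e * atan (z s / (r s - a))) (fun s => e * D s / W s)).
  - exact: ltW.
  - by move=> s _; exact: deriv_G.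
  - move=> s /andP[xs sy]; have ne : r s - a != 0.
      by apply: hne; rewrite (lt_le_trans xx xs) (le_lt_trans sy yy).
    have d2 := is_deriv_comp (@is_deriv_div _ z (fun s => r s - a) s _ _ ne (dz s) (deriv_ra s)) (is_derive1_atan _).
    apply: (is_derive_eq (is_deriv_scale e d2)).
    have W0 := W_neq0 s.
    have W0' : (r s - a) ^+ 2 + z s ^+ 2 != 0 by move: W0; rewrite /W !expr2.
    by rewrite /D /W; field; rewrite ne -!expr2 W0'.
have [h1 h2] := (atan_gtNpi2 (z y / (r y - a)), atan_ltpi2 (z y / (r y - a))).
have [h3 h4] := (atan_gtNpi2 (z x / (r x - a)), atan_ltpi2 (z x / (r x - a))).
have : (e - 1) * (e + 1) = 0.
  have -> : (e - 1) * (e + 1) = e * e - 1 by ring.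
  by rewrite ee subrr.
by move=> /eqP; rewrite mulf_eq0 subr_eq0 addr_eq0 => /orP[]/eqP ->; lra.
Qed.

Lemma total_curvature_le : (forall s, u < s < v -> r s - a != 0) ->
  (forall s, v < s < u + L -> r s - a != 0) -> K (u + L) - K u <= 2 * pi.
Proof.
move=> h1 h2; have := arc_angle_le uv h1; have := arc_angle_le vu h2.
have : G (u + L) - G u = K (u + L) - K u.
  by rewrite /G /N /D pr pz pr1 pz1; ring.
lra.
Qed.

(* Minkowski's formula: [N' = 1 - kap * (e * D)] has integral [0]. *)
Lemma perimeter_le (M : R) : (forall s, 0 <= kap s) ->
  (forall s, `|r s - a| + `|z s| <= M) -> L <= M * (K (u + L) - K u).
Proof.
move=> k0 hM.
have L0 : 0 < L by rewrite -(ltrD2l u) addr0; exact: lt_trans vu.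
have dF (s : R) : is_derive s 1 (fun s => N s + M * K s)
    (1 - kap s * (e * D s) + M * kap s).
  by apply: is_deriv_add; exact: deriv_N.
have : (u + L) - u <= (N (u + L) + M * K (u + L)) - (N u + M * K u).
  apply: (@deriv_le _ id (fun s => N s + M * K s) (fun=> 1) _ u (u + L)) => //.
  - lra.
  - move=> s _; suff : e * D s <= M by have := k0 s; nra.
    apply: le_trans (hM s); apply: le_trans (ler_norm _) _.
    rewrite normrM; have -> : `|e| = 1.
      by apply/eqP; rewrite -(@eqrXn2 _ 2)// expr1n -normrX expr2 ee normr1.
    rewrite mul1r /D; apply: le_trans (ler_normB _ _) _.
    have u1 := unit s.
    have [b1 b2] : `|r1 s| <= 1 /\ `|z1 s| <= 1.
      by split; rewrite ler_norml; apply/andP; split; nra.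
    by rewrite !normrM; apply: lerD; rewrite ler_piMr.
have -> : N (u + L) = N u by rewrite /N pr pz pr1 pz1.
lra.
Qed.

End closed_curve.

(** * Area integrals *)

Section area.
Context {R : realType}.
Notation mu := (@lebesgue_measure R).

(** For the product sigma-algebra, [U] is written as the union of the countably many squares with
    rational centre and half-side [1 / (k + 1)] that it contains. A square around [x] fits once
    [2 / (k + 1) < e], because its points are within two half-sides of [x]. *)
Lemma open_plane_measurable (U : set (plane R)) : open U ->
  measurable (U : set (measurableTypeR R * measurableTypeR R)).
Proof.
move=> oU.
pose box (k : nat) (a b : rat) : set (R * R) :=
  `](ratr a : R) - k.+1%:R^-1, ratr a + k.+1%:R^-1[ `*`
  `](ratr b : R) - k.+1%:R^-1, ratr b + k.+1%:R^-1[.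
pose F k a b := if `[< box k a b `<=` U >] then box k a b else set0.
have -> : U = \bigcup_k \bigcup_a \bigcup_b F k a b.
  apply/seteqP; split=> [x Ux|x [k _ [a _ [b _]]]]; last first.
    by rewrite /F; case: asboolP => // h /h.
  have /nbhs_boxP[e [e0 he]] := oU x Ux.
  have [k hk] : exists k : nat, 2 * k.+1%:R^-1 < e.
    exists (Num.trunc (2 / e)); have h := truncnS_gt (2 / e).
    by rewrite ltr_pdivrMr// in h; rewrite ltr_pdivrMr ?ltr0n// mulrC.
  have k0 : (0 : R) < k.+1%:R^-1 by rewrite invr_gt0 ltr0n.
  have [d dE] : exists d : R, d = k.+1%:R^-1 by exists k.+1%:R^-1.
  rewrite -dE in hk k0.
  have hr (y : R) : exists a : rat, y - d < ratr a < y + d.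
    have [|a] := @rat_in_itvoo R (y - d) (y + d); first by lra.
    by rewrite in_itv /= => ?; exists a.
  have [a /andP[a1 a2]] := hr x.1; have [b /andP[b1 b2]] := hr x.2.
  exists k => //; exists a => //; exists b => //; rewrite /F; case: asboolP => [_|].
    by rewrite /box -dE; split=> /=; rewrite in_itv /=; apply/andP; split; lra.
  case; rewrite /box -dE => y [/=]; rewrite !in_itv /= => /andP[y1 y2] /andP[y3 y4].
  by apply: he; rewrite ltr_norml; apply/andP; split; lra.
apply: bigcupT_measurable => k; apply: bigcupT_measurable_rat => a.
apply: bigcupT_measurable_rat => b; rewrite /F; case: asboolP => // _.
by apply: measurableX; exact: measurable_itv.
Qed.

Lemma bounded_measurable_integrable_itv (g : R -> R) (a b C : R) :
  measurable_fun setT g -> (forall t, 0 <= g t <= C) ->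
  mu.-integrable `[a, b] (EFin \o g).
Proof.
move=> mg hg; apply: measurable_bounded_integrable => //.
- by rewrite /= lebesgue_measure_itv /=; case: ifP => // _; rewrite -EFinB ltry.
- exact: measurable_funTS.
- exists C; split; first exact: num_real.
  move=> M CM t _ /=; have /andP[g0 gC] := hg t.
  by rewrite ger0_norm// (le_trans gC) ?ltW.
Qed.

(* The change of variables [w = y s], as an inequality: the increments of
   [V (y s) - P s] are at most quadratic in those of [s], so this function does not
   increase. *)
Lemma slab_Rintegral_le (g y y1 ph P : R -> R) (a b zm C Lam : R) :
  measurable_fun setT g -> (forall t, 0 <= g t <= C) ->
  a <= b -> (forall s : R, is_derive s 1 y (y1 s)) ->
  (forall s, a < s < b -> 0 <= y1 s) -> (forall s, y1 s <= 1) ->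
  y a = - zm -> y b = zm ->
  (forall s, a <= s <= b -> g (y s) <= ph s) ->
  0 <= Lam ->
  (forall s t, a <= s -> s <= t -> t <= b -> `|ph t - ph s| <= Lam * (t - s)) ->
  (forall s : R, is_derive s 1 P (ph s * y1 s)) ->
  \int[mu]_(t in `[(- zm), zm]) g t <= P b - P a.
Proof.
move=> mg hg ab dy y10 y11 ya yb gph Lam0 phL dP.
pose V t := \int[mu]_(x in `[(- zm), t]) g x.
have ymono s t : a <= s -> s <= t -> t <= b -> y s <= y t.
  move=> as_ st tb; apply: (@ge0_deriv_le _ _ y1) => // x /andP[sx xt].
  by apply: y10; rewrite (le_lt_trans as_ sx) (lt_le_trans xt tb).
have y1nn s : a <= s <= b -> y s <= zm /\ - zm <= y s.
  by move=> /andP[h1 h2]; rewrite -{1}yb -ya; split; apply: ymono.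
(* By the intermediate value theorem each height [w] between [y s] and [y t] is some [y x], so
   [g w <= ph x <= ph s + Lam * (t - s)]. *)
have Vinc s t : a <= s -> s <= t -> t <= b ->
    V (y t) - V (y s) <= (ph s + Lam * (t - s)) * (y t - y s).
  move=> as_ st tb; have yst := ymono _ _ as_ st tb.
  have ys1 : - zm <= y s by rewrite -ya; apply: ymono => //; exact: le_trans tb.
  rewrite /V Rintegral_itvB; first last.
  - by rewrite bnd_simp.
  - by rewrite bnd_simp.
  - exact: bounded_measurable_integrable_itv mg hg.
  have mI : measurable (`]y s, y t] : set (measurableTypeR R)) by exact: measurable_itv.
  have fmu : fine (mu `]y s, y t]) = y t - y s.
    by rewrite lebesgue_measure_itv /= lte_fin; case: ltP => // h /=; lra.
  have fin : (mu `]y s, y t] < +oo)%E.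
    by rewrite lebesgue_measure_itv /=; case: ifP => // _; rewrite -EFinB ltry.
  rewrite -fmu -(Rintegral_cst mu mI); apply: le_Rintegral => //.
  - apply: (integrableS _ _ _ (bounded_measurable_integrable_itv (y s) (y t) mg hg)) => //.
    by apply: subset_itv; rewrite bnd_simp.
  - apply: measurable_bounded_integrable => //.
    exists `|ph s + Lam * (t - s)|; split; first exact: num_real.
    by move=> M CM w _ /=; exact: ltW.
  - move=> w /=; rewrite in_itv /= => /andP[w1 w2].
    have cy : {within `[s, t], continuous y}.
      by apply: continuous_subspaceT => x; exact: is_derive1_continuous (dy x).
    have [|x] := IVT (v := w) st cy.
      by rewrite ge_min le_max (ltW w1) w2 orbT.
    rewrite in_itv /= => /andP[sx xt] <-.
    apply: (le_trans (gph x _)); first by rewrite (le_trans as_ sx) (le_trans xt tb).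
    have := phL s x as_ sx (le_trans xt tb); rewrite ler_norml => /andP[_].
    have : Lam * (x - s) <= Lam * (t - s) by rewrite ler_wpM2l// lerB.
    lra.
have Pinc s t : a <= s -> s <= t -> t <= b ->
    (ph s - Lam * (t - s)) * (y t - y s) <= P t - P s.
  move=> as_ st tb; rewrite mulrBr.
  apply: (@deriv_le _ (fun x => (ph s - Lam * (t - s)) * y x) P
    (fun x => (ph s - Lam * (t - s)) * y1 x) (fun x => ph x * y1 x)) => //.
  move=> x /andP[sx xt]; apply: ler_wpM2r.
    by apply: y10; rewrite (le_lt_trans as_ sx) (lt_le_trans xt tb).
  have := phL s x as_ (ltW sx) (le_trans (ltW xt) tb); rewrite ler_norml => /andP[+ _].
  have : Lam * (x - s) <= Lam * (t - s) by rewrite ler_wpM2l// lerB// ltW.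
  lra.
have ylip s t : s <= t -> y t - y s <= t - s.
  move=> st; apply: (@deriv_le _ y id y1 (fun=> 1)) => //.
have V0 : V (- zm) = 0 by rewrite /V set_itv1 Rintegral_set1.
suff : V (y b) - P b <= V (y a) - P a by rewrite ya yb V0 /V; lra.
(* The bounds [Vinc] and [Pinc] differ by [2 * Lam * (t - s) * (y t - y s)], and
   [y t - y s <= t - s]. *)
apply: (@quadratic_increments_le _ (fun s => V (y s) - P s) a b (2 * Lam) ab).
move=> s t as_ st tb; have h1 := Vinc _ _ as_ st tb; have h2 := Pinc _ _ as_ st tb.
have : Lam * (t - s) * (y t - y s) <= Lam * (t - s) * (t - s).
  by rewrite ler_wpM2l ?ylip// mulr_ge0// subr_ge0.
rewrite expr2; move: (V (y t)) (V (y s)) (P t) (P s) (y t) (y s) (ph s) h1 h2; clear.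
by move=> *; lra.
Qed.

(** By Tonelli the integral is that of the horizontal section integrals [G t]. The section at height
    [y s] lies in [[p s, q s]], so its integral is at most [H (q s) - H (p s)]; sections above [zm]
    or below [- zm] are empty. *)
Lemma slab_integral_le (A : set (measurableTypeR R * measurableTypeR R)) (h H p q y y1 P : R -> R)
    (a b zm B Lam x0 x1 : R) :
  measurable A -> continuous h -> (forall x, 0 <= h x <= B) ->
  (forall x : R, is_derive x 1 H (h x)) ->
  (forall w, A w -> [/\ x0 <= w.1, w.1 <= x1 & `|w.2| <= zm]) ->
  a <= b -> x0 <= x1 -> (forall s : R, is_derive s 1 y (y1 s)) ->
  (forall s, a < s < b -> 0 <= y1 s) -> (forall s, y1 s <= 1) ->
  y a = - zm -> y b = zm ->
  (forall s, a <= s <= b -> p s <= q s) ->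
  (forall s x, a <= s <= b -> A (x, y s) -> p s <= x /\ x <= q s) ->
  0 <= Lam ->
  (forall s t, a <= s -> s <= t -> t <= b ->
    `|(H (q t) - H (p t)) - (H (q s) - H (p s))| <= Lam * (t - s)) ->
  (forall s : R, is_derive s 1 P ((H (q s) - H (p s)) * y1 s)) ->
  (\int[mu \x mu]_(w in A) (h w.1)%:E <= (P b - P a)%:E)%E.
Proof.
move=> mA ch hB dH Abox ab x01 dy y10 y11 ya yb pq Apq Lam0 phL dP.
have mh : measurable_fun setT h by by apply: continuous_measurable_fun.
pose F (w : measurableTypeR R * measurableTypeR R) : \bar R := (h w.1)%:E.
have mF : measurable_fun setT F.
  apply/measurable_EFinP; exact: (measurableT_comp mh measurable_fst).
have mFA : measurable_fun setT (F \_ A).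
  refine ((measurable_restrictT _ mA).1 _).
  exact (@measurable_funTS _ _ _ _ A F mF).
have F0 w : (0 <= (F \_ A) w)%E.
  by rewrite patchE; case: ifP => // _; rewrite lee_fin; case/andP: (hB w.1).
rewrite integral_mkcond (fubini_tonelli2 _ mFA F0).
pose G := fubini_G mu (F \_ A).
have hint s t : s <= t -> (\int[mu]_(x in `[s, t]) (h x)%:E = (H t - H s)%:E)%E.
  move=> st; rewrite -(fineK (integrable_fin_num _ (continuous_itv_integrable s t ch)))//.
  rewrite le_eqVlt in st; case/orP: st => [/eqP <-|st].
    by rewrite set_itv1 integral_set1 subrr.
  by congr (_%:E); exact: (Rintegral_primitive st ch dH).
have G0 t : (0 <= G t)%E by exact: integral_ge0.
have mG : measurable_fun setT G := measurable_fun_fubini_tonelli_G _ mFA F0.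
have Gle t s s' : s <= s' -> (forall x, A (x, t) -> s <= x /\ x <= s') ->
    (G t <= (H s' - H s)%:E)%E.
  move=> ss hA; rewrite -hint// /G /fubini_G [leRHS]integral_mkcond.
  apply: ge0_le_integral => //.
  - exact (measurable_fun_pair1 t mFA).
  - refine ((measurable_restrictT _ (measurable_itv _)).1 _).
    apply/measurable_EFinP; exact (@measurable_funTS _ _ _ _ _ _ mh).
  - move=> x _; rewrite !patchE; case: ifPn => [|_].
      rewrite inE => /hA[sx xs]; rewrite mem_set//= in_itv /=.
      by rewrite sx xs.
    case: ifP => // _; rewrite lee_fin; by case/andP: (hB x).
have Gout t : zm < `|t| -> G t = 0%E.
  move=> ht; rewrite /G /fubini_G; apply: integral0_eq => x _.
  rewrite patchE; case: ifPn => //; rewrite inE => /Abox[_ _].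
  by rewrite leNgt ht.
have GC t : (G t <= (H x1 - H x0)%:E)%E.
  by apply: Gle => // x /Abox[].
pose g t := fine (G t).
have Gg t : G t = (g t)%:E.
  rewrite fineK// ge0_fin_numE//; exact: le_lt_trans (GC t) (ltry _).
have mg : measurable_fun setT g.
  apply/measurable_EFinP; have -> : EFin \o g = G by apply/funext => t; rewrite /= Gg.
  exact mG.
have gC t : 0 <= g t <= H x1 - H x0 by rewrite -!lee_fin -Gg G0 GC.
have ig := bounded_measurable_integrable_itv (- zm) zm mg gC.
have -> : (\int[mu]_t G t = (\int[mu]_(t in `[(- zm), zm]) g t)%:E)%E.
  rewrite /Rintegral fineK; last exact: (integrable_fin_num _ ig).
  rewrite [RHS]integral_mkcond; apply: eq_integral => t _; rewrite patchE.
  case: ifPn => [_|]; first exact: Gg.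
  rewrite notin_setE /= in_itv /= => hn; apply: Gout; rewrite ltNge; apply/negP.
  by rewrite ler_norml.
rewrite lee_fin; apply: (@slab_Rintegral_le g y y1 (fun s => H (q s) - H (p s))
  P a b zm (H x1 - H x0) Lam) => //.
- by move=> s hs; rewrite -lee_fin -Gg; apply: Gle; [exact: pq|move=> x; exact: Apq].
Qed.

End area.

(** * Area, first moment and inverse-square moment of the cross-section *)

Section cross_section_area.
Context {R : realType} (E : set (plane R)) (c : R -> plane R) (L : R).
Context (n : plane R -> plane R).
Hypothesis cs : cross_section E c L.
Hypothesis on : outer_unit_normal E c n.
Notation mu := (@lebesgue_measure R).

Let r (s : R) : R := (c s).1.
Let z (s : R) : R := (c s).2.
Let r1 (s : R) : R := (derive1 c s).1.
Let z1 (s : R) : R := (derive1 c s).2.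

Context (e u v rt zm rmin rmax : R).
Hypothesis spec : arcs_spec E c L e u v rt zm rmin rmax.

Let E0 : set (measurableTypeR R * measurableTypeR R) := E°.

Lemma measurable_interior : measurable E0.
Proof. by apply: open_plane_measurable; exact: open_interior. Qed.

Lemma interior_bounds (w : plane R) : E° w -> [/\ rmin <= w.1, w.1 <= rmax & `|w.2| < zm].
Proof.
move=> Ew; have [_ _ [hx hz _ _ _] _ _] := spec.
have [h1 h2] := hx _ (interior_closure Ew); split=> //.
have /nbhs_boxP[d [d0 hd]] := Ew.
have h3 : closure E (w.1, w.2 + d / 2).
  apply/subset_closure/hd => /=; first by rewrite subrr normr0.
  by rewrite addrAC subrr add0r gtr0_norm; lra.
have h4 : closure E (w.1, w.2 - d / 2).
  apply/subset_closure/hd => /=; first by rewrite subrr normr0.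
  by rewrite addrAC subrr add0r normrN gtr0_norm; lra.
have := hz _ h3; have := hz _ h4; rewrite /= !ler_norml ltr_norml.
by move=> /andP[? ?] /andP[? ?]; apply/andP; split; lra.
Qed.

(** Otherwise [c s] would lie between the interior point [(x, z s)] and the chord point [(rt, z s)],
    hence be interior itself. *)
Lemma row_right s x : E° (x, z s) -> rt <= x -> rt <= r s -> x <= r s.
Proof.
have cE := cs_convex cs; have [_ _ [_ _ _ _ chord] _ [_ _ _ _ slice]] := spec.
move=> Ex rx rs; rewrite leNgt; apply/negP => hx.
have [_ []] := curve_boundary cs s; have [_ _ /= zs] := interior_bounds Ex.
move: rs; rewrite le_eqVlt => /orP[/eqP rs|rs].
  by rewrite [c s]surjective_pairing -/(r s) -rs; exact: chord.
apply: (@convex_interior _ E (x, z s) (rt, z s) _ ((x - r s) / (x - rt))) => //.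
- by rewrite divr_ge0; lra.
- by rewrite ltr_pdivrMr; lra.
- exact: slice.
- by rewrite -/(r s) /=; field; lra.
- by rewrite -/(z s) /=; ring.
Qed.

Lemma row_left s x : E° (x, z s) -> x <= rt -> r s <= rt -> r s <= x.
Proof.
have cE := cs_convex cs; have [_ _ [_ _ _ _ chord] _ [_ _ _ _ slice]] := spec.
move=> Ex rx rs; rewrite leNgt; apply/negP => hx.
have [_ []] := curve_boundary cs s; have [_ _ /= zs] := interior_bounds Ex.
move: rs; rewrite le_eqVlt => /orP[/eqP rs|rs].
  by rewrite [c s]surjective_pairing -/(r s) rs; exact: chord.
apply: (@convex_interior _ E (x, z s) (rt, z s) _ ((r s - x) / (rt - x))) => //.
- by rewrite divr_ge0; lra.
- by rewrite ltr_pdivrMr; lra.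
- exact: slice.
- by rewrite -/(r s) /=; field; lra.
- by rewrite -/(z s) /=; ring.
Qed.

(** The heights [e * z] run from [- zm] to [zm] on the right arc for both orientations; by symmetry
    the rows of [E] at heights [e * z] and [z] agree. *)
Lemma mirror_sign x y : E° (x, e * y) -> E° (x, y).
Proof.
have [[ee _ _ _] _ _ _ _] := spec.
have /eqP : (e - 1) * (e + 1) = 0 by lra.
rewrite mulf_eq0 subr_eq0 addr_eq0 => /orP[]/eqP ->; first by rewrite mul1r.
by rewrite mulN1r => /(interior_mirror cs); rewrite opprK.
Qed.

Lemma curve_rmin s : rmin <= r s.
Proof.
have [_ _ [hx _ _ _ _] _ _] := spec.
by case: (hx _ (@curve_closure _ _ _ _ cs s)).
Qed.

(* One half of the divergence theorem for [- r^-1 e_r], by integrating along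
   horizontal lines separately on both sides of the chord [r = rt]. *)
Lemma area_integral_inv_sq_le (P : R -> R) :
  (forall s : R, is_derive s 1 P (e * z1 s / r s)) ->
  area_integral E (fun p => (p.1 ^+ 2)^-1) <= - (P (u + L) - P u).
Proof.
move=> dP.
have [[ee uv vu zm0] [rmin0 rminrt rtrmax _ _] [hx hz _ _ chord] [ru rv zu zv]
  [right_arc left_arc zr zl slice]] := spec.
have x01 : rmin <= rmax by lra.
(* The cut-off at [rmin] makes the integrand continuous and bounded on the whole line without
   changing it on [E]. *)
pose h (x : R) : R := (Num.max x rmin ^+ 2)^-1.
pose B := (rmin ^+ 2)^-1.
have mx x : rmin <= Num.max x rmin by rewrite le_max lexx orbT.
have mx0 x : 0 < Num.max x rmin by apply: lt_le_trans (mx x).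
have hB x : 0 <= h x <= B.
  rewrite /h /B; apply/andP; split; first by rewrite invr_ge0 exprn_ge0// ltW.
  by rewrite lef_pV2 ?posrE ?exprn_gt0// lerXn2r ?nnegrE// ltW.
have ch : continuous h.
  apply: cts_inv; first by move=> x; rewrite expf_neq0// gt_eqF.
  have cm : continuous (fun x : R => Num.max x rmin).
    by move=> x; apply: continuous_max; [exact: cvg_id|exact: cvg_cst].
  exact: (cts_mul cm cm).
have [H dH] := primitive ch.
pose c0 := H rmin + rmin^-1.
have HE x : rmin <= x -> H x = c0 - x^-1.
  move=> rx; have : H x - H rmin = rmin^-1 - x^-1.
    apply: (@inv_sq_primitive _ h) => // y ry.
    by rewrite /h /Num.max ltNge ry.
  by rewrite /c0; lra.
have HL x y : rmin <= x -> rmin <= y -> `|H x - H y| <= B * `|x - y|.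
  move=> rx ry; rewrite (HE _ rx) (HE _ ry).
  have x0 : 0 < x by lra.
  have y0 : 0 < y by lra.
  have -> : c0 - x^-1 - (c0 - y^-1) = (x - y) * (x * y)^-1 by field; lra.
  have xy0 : 0 < x * y by exact: mulr_gt0.
  have e1 : `|(x * y)^-1| = (x * y)^-1 by rewrite ger0_norm// invr_ge0 ltW.
  rewrite normrM e1 [leLHS]mulrC; apply: ler_wpM2r => //.
  by rewrite /B lef_pV2 ?posrE ?exprn_gt0// expr2 ler_pM// ltW.
have [B0 _] := andP (hB 0); have {}B0 := le_trans B0 (proj2 (andP (hB 0))).
have rl s t : s <= t -> `|r t - r s| <= t - s.
  move=> st; rewrite -[leRHS]mul1r; apply: (@deriv_lipschitz _ r r1) => // x.
    by have [dr _ _ _] := curve_deriv cs x; exact: dr.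
  by have [h1 _] := curve_deriv_norm_le cs x; exact: h1.
pose A1 : set (measurableTypeR R * measurableTypeR R) := E0 `&` [set w | rt <= w.1].
pose A2 : set (measurableTypeR R * measurableTypeR R) := E0 `&` [set w | w.1 < rt].
have mE := measurable_interior.
have mA1 : measurable A1.
  apply: measurableI => //.
  have -> : [set w : measurableTypeR R * measurableTypeR R | rt <= w.1] = `[rt, +oo[ `*` setT.
    by apply/seteqP; split=> w /=; rewrite in_itv /= andbT => // -[].
  by apply: measurableX => //; exact: measurable_itv.
have mA2 : measurable A2.
  apply: measurableI => //.
  have -> : [set w : measurableTypeR R * measurableTypeR R | w.1 < rt] = `]-oo, rt[ `*` setT.
    by apply/seteqP; split=> w /=; rewrite in_itv /= => // -[].
  by apply: measurableX => //; exact: measurable_itv.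
have rr s : u <= s <= v -> rt <= r s.
  move=> /andP[us sv]; rewrite le_eqVlt in us; rewrite le_eqVlt in sv.
  case/orP: us => [/eqP <-|us]; first by rewrite /r ru.
  case/orP: sv => [/eqP ->|sv]; first by rewrite /r rv.
  by apply: ltW; apply: right_arc; rewrite us.
have ruL : r (u + L) = rt by rewrite -ru /r (curve_periodic cs).
have rle s : v <= s <= u + L -> r s <= rt.
  move=> /andP[us sv]; rewrite le_eqVlt in us; rewrite le_eqVlt in sv.
  case/orP: us => [/eqP <-|us]; first by rewrite /r rv.
  case/orP: sv => [/eqP ->|sv]; first by rewrite ruL.
  by apply: ltW; apply: left_arc; rewrite us.
(* Since [H x = c0 - x^-1] on [E], this is the primitive required by the slab estimate; its second
   term is periodic and drops out over the whole curve. *)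
pose Q s := - P s + (c0 - H rt) * (e * z s).
have dQ (s : R) : is_derive s 1 Q ((H (r s) - H rt) * (e * z1 s)).
  have [_ dz _ _] := curve_deriv cs s.
  apply: (is_derive_eq (is_deriv_add (is_deriv_opp (dP s)) (is_deriv_scale _ (is_deriv_scale e dz)))).
  by rewrite (HE _ (curve_rmin s)) -/(z1 s); ring.
have dez (s : R) : is_derive s 1 (fun s => e * z s) (e * z1 s).
  by have [_ dz _ _] := curve_deriv cs s; exact: is_deriv_scale.
have ez1 s : `|e * z1 s| <= 1.
  rewrite normrM; have -> : `|e| = 1.
    by apply/eqP; rewrite -(@eqrXn2 _ 2)// expr1n -normrX expr2 ee normr1.
  by rewrite mul1r; case: (curve_deriv_norm_le cs s).
have I1 : (\int[mu \x mu]_(w in A1) (h w.1)%:E <= (Q v - Q u)%:E)%E.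
  apply: (@slab_integral_le _ A1 h H (fun=> rt) r (fun s => e * z s) (fun s => e * z1 s)
    Q u v zm B B rmin rmax) => //.
  - by move=> w [Ew _]; have [? ? ?] := interior_bounds Ew; split=> //; exact: ltW.
  - exact: ltW.
  - by move=> s; have := ez1 s; rewrite ler_norml => /andP[].
  - move=> s x hs [/mirror_sign Ex rx]; split=> //.
    by apply: row_right => //; exact: rr.
  - move=> s t us st tv; rewrite (_ : _ - _ = H (r t) - H (r s)); last by ring.
    apply: (le_trans (HL _ _ (curve_rmin t) (curve_rmin s))).
    by rewrite ler_wpM2l// rl.
have I2 : (\int[mu \x mu]_(w in A2) (h w.1)%:E <= (Q (u + L) - Q v)%:E)%E.
  (* Along the left arc [e * z] decreases, so [- (e * z)] is used as the height, and mirror symmetry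
     brings the row back to the one through [c s]. The two sign changes cancel, whence the same
     primitive [Q]. *)
  apply: (@slab_integral_le _ A2 h H r (fun=> rt) (fun s => - (e * z s)) (fun s => - (e * z1 s))
    Q v (u + L) zm B B rmin rmax) => //.
  - by move=> w [Ew _]; have [? ? ?] := interior_bounds Ew; split=> //; exact: ltW.
  - exact: ltW.
  - by move=> s hs; rewrite oppr_ge0; exact: zl.
  - by move=> s; have := ez1 s; rewrite ler_norml => /andP[+ _]; rewrite lerNl.
  - by rewrite zv.
  - by rewrite /z (curve_periodic cs) -/(z u) zu opprK.
  - move=> s x hs [Ex' rx].
    have Ex : E° (x, z s).
      by apply: mirror_sign; move/(interior_mirror cs): Ex'; rewrite opprK.
    by split; [apply: row_left => //; [exact: ltW|exact: rle]|exact: ltW].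
  - move=> s t us st tv; rewrite (_ : _ - _ = H (r s) - H (r t)); last by ring.
    apply: (le_trans (HL _ _ (curve_rmin s) (curve_rmin t))).
    by rewrite ler_wpM2l// distrC rl.
  - by move=> s; rewrite mulrN -mulNr opprB; exact: dQ.
have E12 : E0 = A1 `|` A2.
  apply/seteqP; split=> [w Ew|w [[]|[]]] //.
  by have [h1|h1] := leP rt w.1; [left|right]; split.
have h0 w : (0 <= (h w.1)%:E)%E by rewrite lee_fin; case/andP: (hB w.1).
have IE : (\int[mu \x mu]_(w in E0) ((w.1 ^+ 2)^-1)%:E =
    \int[mu \x mu]_(w in A1) (h w.1)%:E + \int[mu \x mu]_(w in A2) (h w.1)%:E)%E.
  rewrite -ge0_integral_setU//.
  - rewrite -E12; apply: eq_integral => w; rewrite inE => Ew.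
    have [+ _ _] := interior_bounds Ew; rewrite /h => hw.
    by congr ((_ ^+ 2)^-1)%:E; rewrite /Num.max ltNge hw.
  - have mh : measurable_fun (setT : set (measurableTypeR R)) h := continuous_measurable_fun ch.
    apply/measurable_EFinP.
    exact (@measurable_funTS _ _ _ _ _ _ (measurableT_comp mh measurable_fst)).
  - apply/disj_setPS => w [[_ /= h1] [_ /= h2]]; lra.
rewrite -lee_fin /area_integral /Rintegral fineK.
  rewrite -/E0 IE; apply: (le_trans (leeD I1 I2)); rewrite -EFinD lee_fin /Q.
  by rewrite /z (curve_periodic cs); lra.
rewrite -/E0 ge0_fin_numE; first rewrite IE.
  by apply: (le_lt_trans (leeD I1 I2)); rewrite -EFinD ltry.
by apply: integral_ge0 => w _; rewrite lee_fin invr_ge0 sqr_ge0.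
Qed.

Lemma rectangle_measure (A B : set (measurableTypeR R)) (x y : R) :
  measurable A -> measurable B -> mu A = x%:E -> mu B = y%:E ->
  (area_measure R) (A `*` B) = (x * y)%:E.
Proof.
move=> mA mB hA hB; transitivity (mu A * mu B)%E; first exact: product_measure1E.
by rewrite hA hB.
Qed.

Lemma interior_measure_le :
  ((area_measure R) E0 <= ((rmax - rmin) * (zm - - zm))%:E)%E.
Proof.
have [[_ _ _ zm0] [rmin0 rminrt rtrmax _ _] _ _ _] := spec.
have sub : E0 `<=` `[rmin, rmax] `*` `[(- zm), zm].
  move=> w /interior_bounds[h1 h2 /ltW h3]; split; rewrite /= in_itv /= -?ler_norml//.
  by rewrite h1 h2.
have mI (a b : R) : measurable (`[a, b] : set (measurableTypeR R)) by exact: measurable_itv.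
apply: (@le_trans _ _ (area_measure R (`[rmin, rmax] `*` `[(- zm), zm]))).
  apply: le_measure => //; rewrite inE; first exact: measurable_interior.
  exact: measurableX.
rewrite (rectangle_measure (x := rmax - rmin) (y := zm - - zm))//.
  by rewrite lebesgue_measure_itv /= lte_fin; have -> : rmin < rmax by lra.
by rewrite lebesgue_measure_itv /= lte_fin; have -> : - zm < zm by lra.
Qed.

Lemma interior_measure_lty : ((area_measure R) E0 < +oo)%E.
Proof. exact: le_lt_trans interior_measure_le (ltry _). Qed.

Lemma area_le : area E <= 2 * zm * (rmax - rmin).
Proof.
rewrite -lee_fin /area fineK ?ge0_fin_numE ?measure_ge0//; last exact: interior_measure_lty.
apply: (le_trans interior_measure_le); rewrite lee_fin; lra.
Qed.

Lemma fst_integrable (f : R -> R) (C : R) : continuous f ->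
  (forall x, rmin <= x <= rmax -> `|f x| <= C) ->
  (area_measure R).-integrable E0 (fun w => (f w.1)%:E).
Proof.
move=> cf hC; have mf : measurable_fun (setT : set (measurableTypeR R)) f :=
  continuous_measurable_fun cf.
apply: (@measurable_bounded_integrable _ _ _ (area_measure R) (fun w => f w.1)).
- exact: measurable_interior.
- exact: interior_measure_lty.
- exact (@measurable_funTS _ _ _ _ _ _ (measurableT_comp mf measurable_fst)).
- exists C; split; first exact: num_real.
  move=> M CM w /interior_bounds[h1 h2 _] /=.
  by apply: le_trans (ltW CM); apply: hC; rewrite h1 h2.
Qed.

(** The hull of the chord and the axis points at [rmin] and [rmax] has half-height at least [zm / 2]
    from [(rmin + rt) / 2] to [(rmax + rt) / 2]. Only the right half of this rectangle is kept, so
    that its abscissae exceed [rmax / 4]. *)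
Lemma half_rectangle_sub (x y : R) : (rmin + rmax + 2 * rt) / 4 < x ->
  x < (rmax + rt) / 2 -> `|y| < zm / 2 -> E° (x, y).
Proof.
have [[_ _ _ zm0] [rmin0 rminrt rtrmax Emin Emax] [_ _ _ _ chord] _ _] := spec.
move=> x1 x2 hy; have cE := cs_convex cs.
have gen (q t : R) : closure E (q, 0) -> 0 <= t -> t < 2^-1 ->
    x = (1 - t) * rt + t * q -> E° (x, y).
  move=> Eq t0 t1 hx; have t2 : 0 < 1 - t by lra.
  apply: (@convex_interior _ E (rt, y / (1 - t)) (q, 0) _ t) => //=.
  - by lra.
  - apply: chord; rewrite normrM normfV (gtr0_norm t2) ltr_pdivrMr//.
    by apply: (lt_le_trans hy); nra.
  - by field; lra.
have [xrt|xrt] := leP rt x.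
  apply: (gen rmax ((x - rt) / (rmax - rt))) => //.
  - by rewrite divr_ge0; lra.
  - by rewrite ltr_pdivrMr; lra.
  - by field; lra.
apply: (gen rmin ((rt - x) / (rt - rmin))) => //.
- by rewrite divr_ge0; lra.
- by rewrite ltr_pdivrMr; lra.
- by field; lra.
Qed.

Lemma half_rectangle_area : exists2 Q : set (measurableTypeR R * measurableTypeR R),
  measurable Q & [/\ Q `<=` E0, forall w, Q w -> rmax / 4 <= w.1 &
    (area_measure R) Q = ((rmax - rmin) * zm / 4)%:E].
Proof.
have [[_ _ _ zm0] [rmin0 rminrt rtrmax _ _] _ _ _] := spec.
pose a := (rmin + rmax + 2 * rt) / 4; pose b := (rmax + rt) / 2.
have mI (x y : R) : measurable (`]x, y[ : set (measurableTypeR R)) by exact: measurable_itv.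
exists (`]a, b[ `*` `](- (zm / 2)), (zm / 2)[); first exact: measurableX.
split.
- move=> [x y] [/=]; rewrite !in_itv /= => /andP[h1 h2] h3.
  by apply: half_rectangle_sub => //; rewrite ltr_norml.
- move=> [x y] [/=]; rewrite !in_itv /= => /andP[h1 h2] h3.
  by rewrite /a in h1; lra.
- rewrite (rectangle_measure (x := b - a) (y := zm / 2 - - (zm / 2)))//.
  + by congr (_%:E); rewrite /a /b; field.
  + by rewrite lebesgue_measure_itv /= lte_fin; have -> : a < b by rewrite /a /b; lra.
  + by rewrite lebesgue_measure_itv /= lte_fin; have -> : - (zm / 2) < zm / 2 by lra.
Qed.

Lemma area_gt0 : 0 < area E.
Proof.
have [[_ _ _ zm0] [rmin0 rminrt rtrmax _ _] _ _ _] := spec.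
have [Q mQ [QE _ muQ]] := half_rectangle_area.
rewrite -lte_fin /area fineK ?ge0_fin_numE ?measure_ge0//; last exact: interior_measure_lty.
apply: (@lt_le_trans _ _ ((area_measure R) Q)).
  by rewrite muQ lte_fin !mulr_gt0//; lra.
by apply: le_measure => //; rewrite inE//; exact: measurable_interior.
Qed.

(** The half rectangle has area [(rmax - rmin) * zm / 4], at least one eighth of [area E] by
    [area_le], and [r >= rmax / 4] on it; this is the origin of [32]. *)
Lemma first_moment_ge : rmax / 32 * area E <= area_integral E (fun p => p.1).
Proof.
have [[_ _ _ zm0] [rmin0 rminrt rtrmax _ _] _ _ _] := spec.
have [Q mQ [QE Qge muQ]] := half_rectangle_area.
apply: (@le_trans _ _ (rmax / 4 * ((rmax - rmin) * zm / 4))).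
  have := area_le; have : 0 < rmax by lra.
  nra.
have ir : (area_measure R).-integrable E0 (fun w => (w.1)%:E).
  apply: (@fst_integrable id rmax); first by move=> x; exact: cvg_id.
  by move=> x /andP[x1 x2]; rewrite ger0_norm; lra.
rewrite -lee_fin /area_integral /Rintegral fineK; last first.
  by apply: (integrable_fin_num _ ir); exact: measurable_interior.
apply: (@le_trans _ _ (\int[mu \x mu]_(w in Q) (rmax / 4)%:E)%E).
  rewrite integral_cst//; apply: (@le_trans _ _ ((rmax / 4)%:E * area_measure R Q)%E) => //.
  by rewrite muQ.
apply: (@le_trans _ _ (\int[mu \x mu]_(w in Q) (w.1)%:E)%E).
  apply: ge0_le_integral => //.
  - by move=> w _; rewrite lee_fin; lra.
  - apply/measurable_EFinP; exact (@measurable_funTS _ _ _ _ _ _ measurable_fst).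
apply: ge0_subset_integral => //.
- exact: measurable_interior.
- apply/measurable_EFinP; exact (@measurable_funTS _ _ _ _ _ _ measurable_fst).
- by move=> w /interior_bounds[h1 _ _]; rewrite lee_fin; lra.
Qed.

(* Jensen: [x^-2] lies above its tangent at [m]. *)
Lemma inv_sq_moment_ge (m : R) : 0 < m ->
  3 / m ^+ 2 * area E - 2 / m ^+ 3 * area_integral E (fun p => p.1)
    <= area_integral E (fun p => (p.1 ^+ 2)^-1).
Proof.
have [[_ _ _ zm0] [rmin0 rminrt rtrmax _ _] _ _ _] := spec.
move=> m0; pose h (x : R) : R := (Num.max x rmin ^+ 2)^-1.
have mx0 x : 0 < Num.max x rmin by rewrite lt_max rmin0 orbT.
have ch : continuous h.
  apply: cts_inv; first by move=> x; rewrite expf_neq0// gt_eqF.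
  have cm : continuous (fun x : R => Num.max x rmin).
    by move=> x; apply: continuous_max; [exact: cvg_id|exact: cvg_cst].
  exact: (cts_mul cm cm).
have hE w : E0 w -> h w.1 = (w.1 ^+ 2)^-1.
  by move=> /interior_bounds[h1 _ _]; rewrite /h /Num.max ltNge h1.
have ir : (area_measure R).-integrable E0 (fun w => (w.1)%:E).
  apply: (@fst_integrable id rmax); first by move=> x; exact: cvg_id.
  by move=> x /andP[x1 x2]; rewrite ger0_norm; lra.
have ih : (area_measure R).-integrable E0 (fun w => (h w.1)%:E).
  apply: (@fst_integrable h (rmin ^+ 2)^-1) => // x /andP[x1 x2].
  rewrite ger0_norm /h ?invr_ge0 ?exprn_ge0 ?(ltW (mx0 _))//.
  have h1 : rmin <= Num.max x rmin by rewrite le_max lexx orbT.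
  by rewrite lef_pV2 ?posrE ?exprn_gt0// lerXn2r// nnegrE ltW.
have mE := measurable_interior.
have -> : area_integral E (fun p => (p.1 ^+ 2)^-1) = \int[area_measure R]_(w in E0) h w.1.
  by apply: eq_Rintegral => w; rewrite inE => /hE ->.
have ic : (area_measure R).-integrable E0 (fun w => (3 / m ^+ 2)%:E).
  apply: (@fst_integrable (fun=> 3 / m ^+ 2) `|3 / m ^+ 2|); first by move=> x; exact: cvg_cst.
  by [].
have ir2 : (area_measure R).-integrable E0 (fun w => (2 / m ^+ 3 * w.1)%:E).
  apply: (@fst_integrable (fun x => 2 / m ^+ 3 * x) (2 / m ^+ 3 * rmax)).
    by apply: cts_mul; [exact: cts_cst|move=> x; exact: cvg_id].
  have k0 : 0 <= 2 / m ^+ 3 by rewrite divr_ge0// exprn_ge0// ltW.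
  by move=> x /andP[x1 x2]; rewrite ger0_norm ?mulr_ge0 ?ler_wpM2l//; lra.
have -> : 3 / m ^+ 2 * area E - 2 / m ^+ 3 * area_integral E (fun p => p.1) =
    \int[area_measure R]_(w in E0) (3 / m ^+ 2 - 2 / m ^+ 3 * w.1).
  by rewrite RintegralB// Rintegral_cst// RintegralZl.
apply: le_Rintegral => //; first exact: (integrableB mE ic ir2).
move=> w Ew; rewrite hE//; have [h1 _ _] := interior_bounds Ew.
have w0 : 0 < w.1 by lra.
rewrite -subr_ge0.
have -> : (w.1 ^+ 2)^-1 - (3 / m ^+ 2 - 2 / m ^+ 3 * w.1) =
  (w.1 - m) ^+ 2 * (2 * w.1 + m) / (w.1 ^+ 2 * m ^+ 3) by field; lra.
have [w0' m0'] := (ltW w0, ltW m0).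
apply: divr_ge0; apply: mulr_ge0; rewrite ?sqr_ge0 ?exprn_ge0//.
by apply: addr_ge0 => //; apply: mulr_ge0.
Qed.

End cross_section_area.

(** * One-sided normal derivatives *)

Section one_variable.
Context {R : realType}.

Lemma approx_is_derive (f : R -> R) (x d : R) :
  (forall e : R, 0 < e -> exists2 del : R, 0 < del &
    forall h : R, `|h| < del -> `|f (x + h) - f x - h * d| <= e * `|h|) ->
  is_derive x 1 f d.
Proof.
move=> happ.
have lim : h^-1 *: (f (h + x) - f x) @[h --> 0^'] --> d.
  apply/cvgrPdist_le => e e0; have [del del0 hdel] := happ e e0.
  apply/nbhs_ballP; exists del => //= h; rewrite -ball_normE /= sub0r normrN => hh h0.
  have nh0 : 0 < `|h| by rewrite normr_gt0.
  rewrite -(ler_pM2r nh0) -normrM.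
  have -> : (d - h^-1 *: (f (h + x) - f x)) * h = - (f (x + h) - f x - h * d).
    by rewrite /GRing.scale /= [h + x]addrC; field.
  by rewrite normrN; exact: hdel.
apply: DeriveDef.
  apply/cvg_ex; exists d; rewrite /= (_ : (fun _ => _) = (fun h => h^-1 *: (f (h + x) - f x)))//.
  by apply/funext => h; rewrite [_%:A]mulr1.
rewrite /derive (_ : (fun _ => _) = (fun h => h^-1 *: (f (h + x) - f x))).
  exact/cvg_lim.
by apply/funext => h /=; rewrite [_%:A]mulr1.
Qed.

Lemma increment_approx (k dk : R -> R) (a d D e : R) :
  (forall x, `|x - a| <= `|d| -> is_derive x 1 k (dk x)) ->
  (forall x, `|x - a| <= `|d| -> `|dk x - D| <= e) ->
  `|k (a + d) - k a - d * D| <= e * `|d|.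
Proof.
move=> hk hD; have [d0|d0] := leP 0 d.
  have ad : a <= a + d by rewrite lerDl.
  have inr x : a <= x <= a + d -> `|x - a| <= `|d|.
    by move=> /andP[h1 h2]; rewrite !ger0_norm; lra.
  have [x /inr xad ->] := deriv_MVT ad (fun x h => hk x (inr x h)).
  have -> : a + d - a = d by rewrite addrAC subrr add0r.
  rewrite -[d * D]mulrC -mulrBl normrM ler_wpM2r//; exact: hD.
have ad : a + d <= a by lra.
have inr x : a + d <= x <= a -> `|x - a| <= `|d|.
  by move=> /andP[h1 h2]; rewrite (ltr0_norm d0) ler0_norm; lra.
have [x /inr xad he] := deriv_MVT ad (fun x h => hk x (inr x h)).
have -> : k (a + d) - k a - d * D = d * (dk x - D).
  have -> : k (a + d) - k a = - (k a - k (a + d)) by rewrite opprB.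
  by rewrite he; ring.
by rewrite normrM mulrC ler_wpM2r//; exact: hD.
Qed.

(** The mean value theorem is applied on [[t0', t]] with small [t0' > 0], since [g] is
    differentiable only on the open side; right continuity at [0] then replaces [t0'] by [0]. *)
Lemma right_derivative_limit (g dg : R -> R) (del d : R) : 0 < del ->
  (forall t, 0 < t < del -> is_derive t 1 g (dg t)) ->
  (forall e : R, 0 < e -> exists2 eta : R, 0 < eta &
    forall t, 0 < t < eta -> `|dg t - d| <= e) ->
  (forall e : R, 0 < e -> exists2 eta : R, 0 < eta &
    forall t, 0 < t < eta -> `|g t - g 0| <= e) ->
  (t^-1 * (g t - g 0)) @[t --> 0^'+] --> d.
Proof.
move=> del0 hg hdg hcont; apply/cvgrPdist_le => e e0.
have [eta eta0 heta] := hdg e e0.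
have close t : 0 < t < Num.min eta del -> `|g t - g 0 - t * d| <= e * t.
  rewrite lt_min => /andP[t0 /andP[teta tdel]]; apply/ler_addgt0Pr => k k0.
  have dk : 0 < k / (2 * (`|d| + 1)) by rewrite divr_gt0// mulr_gt0// ltr_wpDl.
  have k2 : 0 < k / 2 by rewrite divr_gt0.
  have [et2 et20 het2] := hcont _ k2.
  (* Both errors of replacing [t0'] by [0], namely [g t0' - g 0] and [t0' * d], are at most [k / 2];
     the [+ 1] covers the case [d = 0]. *)
  pose t0' := Num.min (et2 / 2) (Num.min (t / 2) (k / (2 * (`|d| + 1)))).
  have t0'0 : 0 < t0' by rewrite !lt_min !divr_gt0//= dk.
  have [h1 h2 h3] : [/\ t0' <= et2 / 2, t0' <= t / 2 & t0' <= k / (2 * (`|d| + 1))].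
    by rewrite /t0' !ge_min !lexx ?orbT.
  have c1 : `|g t0' - g 0| <= k / 2 by apply: het2; rewrite t0'0; lra.
  have c2 : `|g (t0' + (t - t0')) - g t0' - (t - t0') * d| <= e * `|t - t0'|.
    have tt : `|t - t0'| = t - t0' by rewrite ger0_norm; lra.
    have tle : t0' <= t by lra.
    have [x|x /andP[x1 x2] hx] := @deriv_MVT _ g dg t0' t tle.
      by move=> /andP[x1 x2]; apply: hg; apply/andP; split; lra.
    rewrite [t0' + _]addrC subrK hx -[_ * d]mulrC -mulrBl normrM ler_wpM2r//.
    by apply: heta; apply/andP; split; lra.
  have -> : g t - g 0 - t * d = (g (t0' + (t - t0')) - g t0' - (t - t0') * d)
      + (g t0' - g 0) - t0' * d by rewrite [t0' + _]addrC subrK; ring.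
  have c3 : `|t0' * d| <= k / 2.
    rewrite normrM (gtr0_norm t0'0).
    apply: (@le_trans _ _ (k / (2 * (`|d| + 1)) * (`|d| + 1))).
      by apply: ler_pM => //; [exact: ltW|rewrite lerDl].
    rewrite le_eqVlt; apply/orP; left; apply/eqP; field.
    by rewrite gt_eqF// ltr_wpDl.
  have c2' : e * `|t - t0'| <= e * t by rewrite ler_pM2l// ger0_norm; lra.
  apply: (le_trans (ler_normB _ _)); apply: (le_trans (lerD (ler_normD _ _) c3)).
  lra.
have near0 : \forall t \near (0 : R)^'+, 0 < t < Num.min eta del.
  have m0 : 0 < Num.min eta del by rewrite lt_min eta0.
  near=> t; apply/andP; split; [near: t; exact: nbhs_right_gt|near: t; exact: nbhs_right_lt].
apply: filterS near0 => t ht; have /andP[t0 _] := ht.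
have -> : d - t^-1 * (g t - g 0) = - (g t - g 0 - t * d) / t by field; lra.
by rewrite normrM normrN normfV (gtr0_norm t0) ler_pdivrMr//; exact: close.
Unshelve. all: by end_near.
Qed.

End one_variable.

Section several_variables.
Context {R : realType}.

Lemma within_continuous_box (A : set (plane R)) (f : plane R -> R^o) (p : plane R) :
  {within A, continuous f} -> A p -> forall e : R, 0 < e -> exists2 d : R, 0 < d &
  forall q, A q -> `|q.1 - p.1| < d -> `|q.2 - p.2| < d -> `|f q - f p| <= e.
Proof.
move=> cf Ap e e0.
have /cvgrPdist_le/(_ e e0) := cf p.
move=> h; have : within A (nbhs p) [set t | `|f p - f t| <= e].
  by rewrite (nbhs_subspace_in Ap); exact: h.
move=> /nbhs_boxP[d [d0 hd]].
by exists d => // q Aq h1 h2; rewrite distrC; apply: hd.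
Qed.

Lemma is_derive_er (f : plane R -> R^o) (p : plane R) : derivable f p er ->
  is_derive p.1 1 (fun x : R => f (x, p.2) : R) ('D_er f p).
Proof.
move=> hd; pose k := (fun x : R => f (x, p.2) : R).
have e : (fun h : R => h^-1 *: ((k \o shift p.1) (h *: 1) - k p.1)) =
    (fun h : R => h^-1 *: ((f \o shift p) (h *: er) - f p)).
  apply/funext => h; rewrite /k -surjective_pairing; congr (_ *: (f _ - _)).
  by apply/pair_equal_spec; rewrite /= /GRing.scale /= !mulr1 mulr0 add0r.
by apply: DeriveDef; [rewrite /derivable e|rewrite /derive e].
Qed.

Lemma is_derive_ez (f : plane R -> R^o) (p : plane R) : derivable f p ez ->
  is_derive p.2 1 (fun y : R => f (p.1, y) : R) ('D_ez f p).
Proof.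
move=> hd; pose k := (fun y : R => f (p.1, y) : R).
have e : (fun h : R => h^-1 *: ((k \o shift p.2) (h *: 1) - k p.2)) =
    (fun h : R => h^-1 *: ((f \o shift p) (h *: ez) - f p)).
  apply/funext => h; rewrite /k -surjective_pairing; congr (_ *: (f _ - _)).
  by apply/pair_equal_spec; rewrite /= /GRing.scale /= !mulr1 mulr0 add0r.
by apply: DeriveDef; [rewrite /derivable e|rewrite /derive e].
Qed.

Lemma continuous_box (f : plane R -> plane R) (p : plane R) :
  {for p, continuous f} -> forall e : R, 0 < e -> exists2 d : R, 0 < d &
  forall q, `|q.1 - p.1| < d -> `|q.2 - p.2| < d ->
    `|(f q).1 - (f p).1| < e /\ `|(f q).2 - (f p).2| < e.
Proof.
move=> cf e e0.
have : nbhs (f p) [set w | `|w.1 - (f p).1| < e /\ `|w.2 - (f p).2| < e].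
  by apply/nbhs_boxP; exists e; split=> // w.
by move=> /cf /nbhs_boxP[d [d0 hd]]; exists d.
Qed.

(** [C1_on] speaks only of partial derivatives. The increment is split into a horizontal and a
    vertical one, each controlled by the mean value theorem and the continuity of the gradient. *)
Lemma C1_is_derive_line (U : set (plane R)) (f : plane R -> R^o) (q nu : plane R) (t : R) :
  open U -> C1_on U f -> U (q + t *: nu) ->
  is_derive t 1 (fun t : R => f (q + t *: nu) : R)
    (nu.1 * 'D_er f (q + t *: nu) + nu.2 * 'D_ez f (q + t *: nu)).
Proof.
move=> oU C1 Up; set p := q + t *: nu in Up *.
have [_ _ cgrad] := C1 p Up.
pose M := `|nu.1| + `|nu.2| + 1.
have M0 : 0 < M by rewrite /M ltr_wpDl ?addr_ge0.
apply: approx_is_derive => e e0.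
have eM : 0 < e / M by rewrite divr_gt0.
have [d1 d10 hd1] := continuous_box cgrad eM.
have /nbhs_boxP[d2 [d20 hd2]] := oU p Up.
pose d := Num.min d1 d2; have d0 : 0 < d by rewrite lt_min d10.
have hd w : `|w.1 - p.1| < d -> `|w.2 - p.2| < d -> [/\ U w,
    `|'D_er f w - 'D_er f p| <= e / M & `|'D_ez f w - 'D_ez f p| <= e / M].
  rewrite !lt_min => /andP[a1 a2] /andP[b1 b2]; split; first exact: hd2.
    by have [h _] := hd1 w a1 b1; exact: ltW.
  by have [_ h] := hd1 w a1 b1; exact: ltW.
exists (d / M); first by rewrite divr_gt0.
move=> h; rewrite ltr_pdivlMr// => hh.
have hn1 : `|h * nu.1| < d.
  by rewrite normrM; apply: le_lt_trans hh; rewrite ler_wpM2l// /M -addrA lerDl addr_ge0.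
have hn2 : `|h * nu.2| < d.
  rewrite normrM; apply: le_lt_trans hh; rewrite ler_wpM2l// /M.
  by rewrite [_ + `|nu.2|]addrC -addrA lerDl addr_ge0.
have pE : q + (t + h) *: nu = (p.1 + h * nu.1, p.2 + h * nu.2).
  by apply/pair_equal_spec; rewrite /p /= /GRing.scale /= !mulrDl !addrA.
have h1 : `|f (p.1 + h * nu.1, p.2 + h * nu.2) - f (p.1, p.2 + h * nu.2)
    - h * nu.1 * 'D_er f p| <= e / M * `|h * nu.1|.
  apply: (@increment_approx _ (fun x => f (x, p.2 + h * nu.2))
    (fun x => 'D_er f (x, p.2 + h * nu.2))) => x hx.
    have [|Uw _ _] := hd (x, p.2 + h * nu.2) (le_lt_trans hx hn1).
      by rewrite /= addrAC subrr add0r.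
    by have [+ _ _] := C1 _ Uw => /is_derive_er.
  have [|_ + _] := hd (x, p.2 + h * nu.2) (le_lt_trans hx hn1) => //.
  by rewrite /= addrAC subrr add0r.
have h2 : `|f (p.1, p.2 + h * nu.2) - f (p.1, p.2)
    - h * nu.2 * 'D_ez f p| <= e / M * `|h * nu.2|.
  apply: (@increment_approx _ (fun x => f (p.1, x)) (fun x => 'D_ez f (p.1, x))) => x hx.
    have [||Uw _ _] := hd (p.1, x); first by rewrite /= subrr normr0.
      exact: le_lt_trans hx hn2.
    by have [_ + _] := C1 _ Uw => /is_derive_ez.
  have [||_ _ +] := hd (p.1, x) => //; first by rewrite /= subrr normr0.
  exact: le_lt_trans hx hn2.
rewrite pE -[f p](_ : f (p.1, p.2) = _); last by rewrite -surjective_pairing.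
have -> : f (p.1 + h * nu.1, p.2 + h * nu.2) - f (p.1, p.2) -
    h * (nu.1 * 'D_er f p + nu.2 * 'D_ez f p) =
  (f (p.1 + h * nu.1, p.2 + h * nu.2) - f (p.1, p.2 + h * nu.2) - h * nu.1 * 'D_er f p)
  + (f (p.1, p.2 + h * nu.2) - f (p.1, p.2) - h * nu.2 * 'D_ez f p) by ring.
apply: (le_trans (ler_normD _ _)); apply: (le_trans (lerD h1 h2)).
have -> : e / M * `|h * nu.1| + e / M * `|h * nu.2| =
    `|h| * (e / M * (`|nu.1| + `|nu.2|)) by rewrite !normrM; ring.
rewrite [leRHS]mulrC ler_wpM2l// mulrAC ler_pdivrMr// ler_pM2l// /M lerDl.
exact: ler01.
Qed.

Lemma exterior_open (E : set (plane R)) : open (exterior E).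
Proof.
rewrite /exterior setDE; apply: openI; last exact/closed_openC/closed_closure.
move=> p /= p0; apply/nbhs_boxP; exists p.1; split=> // q h _.
by move: h; rewrite /half_plane /= ltr_distl => /andP[]; rewrite subrr.
Qed.

(** [normal_derive] is a bare [lim], so a limit must be exhibited before computing with it; it is
    [nu . G p], for the continuous extension [G] of the gradient. *)
Lemma normal_derivative_cvg (E : set (plane R)) (psi : plane R -> R^o) (p nu : plane R) :
  classical E psi -> (half_plane `\` E°) p ->
  (\forall t \near (0 : R)^'+, exterior E (p + t *: nu)) ->
  exists d : R, t^-1 * (psi (p + t *: nu) - psi p) @[t --> (0 : R)^'+] --> d.
Proof.
move=> [[C1 _ _] cpsi [G [cG GE]]] Ap hext.
have oext := @exterior_open E.
have Ap' : (closed_half_plane `\` E°) p by case: Ap => h1 h2; split=> //; exact: ltW.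
pose N := `|nu.1| + `|nu.2| + 1.
have N0 : 0 < N by rewrite /N ltr_wpDl ?addr_ge0.
have small d t : 0 < t -> t < d / N -> `|(p + t *: nu).1 - p.1| < d /\ `|(p + t *: nu).2 - p.2| < d.
  move=> t0; rewrite ltr_pdivlMr// => ht; rewrite /= /GRing.scale /=.
  rewrite [p.1 + _]addrC addrK [p.2 + _]addrC addrK !normrM (gtr0_norm t0).
  split; apply: le_lt_trans ht; rewrite ler_pM2l// /N.
    by rewrite -addrA lerDl addr_ge0.
  by rewrite [_ + `|nu.2|]addrC -addrA lerDl addr_ge0.
have [del del0 hdel] : exists2 del : R, 0 < del & forall t, 0 < t < del -> exterior E (p + t *: nu).
  have [del /= del0 hd] := hext; exists del => // t /andP[t0 td].
  by apply: hd => //=; rewrite sub0r normrN gtr0_norm.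
have ext_sub w : exterior E w -> (half_plane `\` E°) w.
  by move=> [h1 h2]; split=> // /interior_closure.
have ext_sub' w : exterior E w -> (closed_half_plane `\` E°) w.
  by move=> /ext_sub[h1 h2]; split=> //; exact: ltW.
exists (nu.1 * (G p).1 + nu.2 * (G p).2).
pose g (t : R) : R := psi (p + t *: nu).
have g0 : g 0 = psi p by rewrite /g scale0r addr0.
rewrite -g0; apply: (@right_derivative_limit _ g
  (fun t => nu.1 * 'D_er psi (p + t *: nu) + nu.2 * 'D_ez psi (p + t *: nu)) del) => //.
- move=> t ht; exact: (C1_is_derive_line oext C1 (hdel t ht)).
- move=> e e0; have eN : 0 < e / N by rewrite divr_gt0.
  have cG1 : {within half_plane `\` E°, continuous (fun w => (G w).1 : R^o)}.
    by move=> w; exact: (cvg_comp _ _ (cG w) (@cvg_fst _ _ (nbhs _) (nbhs _) _)).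
  have cG2 : {within half_plane `\` E°, continuous (fun w => (G w).2 : R^o)}.
    by move=> w; exact: (cvg_comp _ _ (cG w) (@cvg_snd _ _ (nbhs _) (nbhs _) _)).
  have [d1 d10 hd1] := within_continuous_box cG1 Ap eN.
  have [d2 d20 hd2] := within_continuous_box cG2 Ap eN.
  pose d := Num.min d1 d2; have d0 : 0 < d by rewrite lt_min d10.
  have dN : 0 < d / N by rewrite divr_gt0.
  exists (Num.min del (d / N)); first by rewrite lt_min del0.
  move=> t /andP[t0]; rewrite lt_min => /andP[td tN].
  have ext := hdel t; rewrite t0 td in ext; have {}ext := ext isT.
  have GW : G (p + t *: nu) = grad psi (p + t *: nu) by apply: GE; rewrite inE.
  have [] := small d t t0 tN; rewrite !lt_min => /andP[a1 a2] /andP[b1 b2].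
  have := hd1 _ (ext_sub _ ext) a1 b1; have := hd2 _ (ext_sub _ ext) a2 b2.
  rewrite GW /grad /= => k2 k1.
  have -> : nu.1 * 'D_er psi (p + t *: nu) + nu.2 * 'D_ez psi (p + t *: nu) -
      (nu.1 * (G p).1 + nu.2 * (G p).2) =
    nu.1 * ('D_er psi (p + t *: nu) - (G p).1) + nu.2 * ('D_ez psi (p + t *: nu) - (G p).2).
    by ring.
  apply: (le_trans (ler_normD _ _)); rewrite !normrM.
  apply: (@le_trans _ _ (`|nu.1| * (e / N) + `|nu.2| * (e / N))).
    by apply: lerD; rewrite ler_wpM2l.
  by rewrite -mulrDl mulrA ler_pdivrMr// mulrC ler_pM2l// /N lerDl.
- move=> e e0; have [d d0 hd] := within_continuous_box cpsi Ap' e0.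
  have dN : 0 < d / N by rewrite divr_gt0.
  exists (Num.min del (d / N)); first by rewrite lt_min del0.
  move=> t /andP[t0]; rewrite lt_min => /andP[td tN].
  have ext := hdel t; rewrite t0 td in ext; have {}ext := ext isT.
  by have [a1 a2] := small d t t0 tN; rewrite g0; apply: hd => //; exact: ext_sub'.
Qed.

Lemma normal_derive_Psi (E : set (plane R)) (psi : plane R -> R^o) (W : R)
    (n : plane R -> plane R) (p : plane R) :
  classical E psi -> (half_plane `\` E°) p ->
  (\forall t \near (0 : R)^'+, exterior E (p + t *: n p)) ->
  normal_derive n (Psi psi W) p = normal_derive n psi p - W * p.1 * (n p).1.
Proof.
move=> cl Ap hext; have [d hd] := normal_derivative_cvg cl Ap hext.
rewrite /normal_derive (cvg_lim _ hd)//; apply/cvg_lim => //.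
have -> : (fun t : R => t^-1 * (Psi psi W (p + t *: n p) - Psi psi W p)) =
    (fun t => t^-1 * (psi (p + t *: n p) - psi p) -
      t^-1 * (W / 2 * ((p + t *: n p).1 ^+ 2 - p.1 ^+ 2))).
  by apply/funext => t; rewrite /Psi; ring.
apply: cvgB => //.
have e : {near (0 : R)^'+, (fun t : R => W * p.1 * (n p).1 + t * (W / 2 * (n p).1 ^+ 2)) =1
    (fun t => t^-1 * (W / 2 * ((p + t *: n p).1 ^+ 2 - p.1 ^+ 2)))}.
  near=> t; have t0 : 0 < t by near: t; exact: nbhs_right_gt.
  by rewrite /= /GRing.scale /=; field; lra.
have cc : continuous (fun t : R => W * p.1 * (n p).1 + t * (W / 2 * (n p).1 ^+ 2)).
  apply: cts_add; first exact: cts_cst.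
  by apply: cts_mul; [move=> t; exact: cvg_id|exact: cts_cst].
have cv := cvg_at_right_filter (cc 0); rewrite mul0r addr0 in cv.
exact: cvg_trans (near_eq_cvg e) cv.
Unshelve. all: by end_near.
Qed.

End several_variables.

(** * The lower bound *)

(* [X] is the largest radius, [h] the height and [L] the perimeter of the
   cross-section. *)
Lemma weber_lower_bound (R : realType) (sigma rho beta A X h L lam del : R) :
  0 < sigma -> 0 < rho -> 0 < A -> 0 < X -> 0 < h -> 0 < L -> 0 <= del ->
  A <= h * X -> 2 * pi * (X / 32) ^+ 2 <= A -> L <= 2 * pi * (X + h / 2) ->
  2 * sigma * del <= lam * L -> h ^+ 2 * (2 * sigma / X + lam) <= rho * beta ^+ 2 ->
  (256 * 128)^-1 * (1 + del) <= Num.sqrt (2 * pi) * rho * beta ^+ 2 / (sigma * Num.sqrt A).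
Proof.
move=> s0 r0 A0 X0 h0 L0 del0 AhX XA Lle lamL hb.
have pi2 : 2 <= pi :> R := pi_ge2 R.
have pi4 : pi <= 4 :> R.
  by have := pihalf_lt2 R; lra.
(* With [2 <= pi], the hypotheses give [4 * (X / 32) ^ 2 <= h * X], which is divided by [X]. *)
have Xh : X <= 256 * h.
  have h1 : 4 * (X / 32) ^+ 2 <= h * X.
    apply: le_trans AhX; apply: le_trans XA; rewrite ler_wpM2r ?sqr_ge0//; lra.
  rewrite -(ler_pM2r X0); move: h1; rewrite expr2; lra.
(* With [pi <= 4] the factor is [8 * (256 + 1 / 2)], rounded up to [8 * 257]. *)
have Lh : L <= 2056 * h.
  apply: (le_trans Lle); apply: (@le_trans _ _ (8 * (X + h / 2))); last lra.
  by rewrite ler_wpM2r; lra.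
have sA : Num.sqrt A <= 16 * h.
  have -> : 16 * h = Num.sqrt ((16 * h) ^+ 2) by rewrite sqrtr_sqr ger0_norm//; lra.
  rewrite ler_wsqrtr//; apply: (le_trans AhX); rewrite expr2.
  have : h * X <= h * (256 * h) by rewrite ler_pM2l.
  lra.
have sA0 : 0 < Num.sqrt A by rewrite sqrtr_gt0.
have sp : 1 <= Num.sqrt (2 * pi) :> R.
  by rewrite -{1}sqrtr1 ler_wsqrtr//; lra.
have lamh : 2 * sigma * del / (2056 * h) <= lam.
  have lam0 : 0 <= lam.
    rewrite -(pmulr_lge0 _ L0); apply: le_trans lamL.
    by apply: mulr_ge0 => //; lra.
  rewrite ler_pdivrMr; last lra.
  apply: (le_trans lamL); rewrite ler_wpM2l//.
have Xinv : 2 * sigma / (256 * h) <= 2 * sigma / X.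
  have h256 : 0 < 256 * h by lra.
  by rewrite ler_pM2l ?lef_pV2 ?posrE//; lra.
(* The two contributions are [sigma * h / 128] and [sigma * h * del / 1028]. Divided by
   [sigma * 16 * h] they become [1 / 2048] and [del / 16448], both covered by the constant
   [1 / (256 * 128)]. *)
have key : sigma * (16 * h) * ((256 * 128)^-1 * (1 + del)) <= rho * beta ^+ 2.
  apply: le_trans hb.
  apply: (@le_trans _ _ (h ^+ 2 * (2 * sigma / (256 * h) + 2 * sigma * del / (2056 * h)))).
    have -> : h ^+ 2 * (2 * sigma / (256 * h) + 2 * sigma * del / (2056 * h)) =
      sigma * h / 128 + sigma * h * del / 1028 by field; lra.
    have : 0 <= sigma * h by rewrite mulr_ge0// ltW.
    have : 0 <= sigma * h * del by rewrite !mulr_ge0// ltW.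
    lra.
  by rewrite ler_wpM2l ?sqr_ge0// lerD.
rewrite ler_pdivlMr ?mulr_gt0//.
apply: (@le_trans _ _ (rho * beta ^+ 2)); last first.
  rewrite -mulrA -[leLHS]mul1r; apply: ler_wpM2r => //.
  by apply: mulr_ge0; [exact: ltW|exact: sqr_ge0].
apply: le_trans key; rewrite [leLHS]mulrC; apply: ler_wpM2r; last by rewrite ler_pM2l.
by apply: mulr_ge0; lra.
Qed.

(* [K], [M] and [B] are primitives of [kappa], [n_r / r] and [- q] along the
   boundary; [I1] and [I2] are the integrals of [r] and [r^-2] over [E]. *)
Lemma ring_estimate (R : realType) (r z z1 kap q K M B : R -> R)
    (e u v zm rmin rmax L sigma rho lam A I1 I2 : R) :
  0 < sigma -> 0 < rho -> u < v -> v < u + L -> 0 < zm -> 0 < rmin ->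
  rmin < rmax ->
  (forall s : R, is_derive s 1 z (z1 s)) ->
  (forall s : R, is_derive s 1 K (kap s)) ->
  (forall s : R, is_derive s 1 M (e * z1 s / r s)) ->
  (forall s : R, is_derive s 1 B (- q s)) ->
  (forall s, 0 < r s) -> (forall s, r s <= rmax) -> (forall s, 0 <= kap s) ->
  (forall s, e * z1 s <= 1) -> (forall s, u < s < v -> 0 <= e * z1 s) ->
  e * z u = - zm -> e * z v = zm ->
  (forall s, rho * q s ^+ 2 = 2 * sigma * (kap s + e * z1 s / r s) + lam) ->
  (forall s, q s <= 0) ->
  K (u + L) - K u <= 2 * pi -> L <= (rmax + zm) * (K (u + L) - K u) ->
  I2 <= - (M (u + L) - M u) ->
  0 < A -> A <= 2 * zm * (rmax - rmin) -> rmax / 32 * A <= I1 ->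
  (forall m, 0 < m -> 3 / m ^+ 2 * A - 2 / m ^+ 3 * I1 <= I2) ->
  2 * pi * (A^-1 * I1) ^+ 2 <= A ->
  (256 * 128)^-1 * (1 + (I2 - 2 * pi)) <=
    Num.sqrt (2 * pi) * rho * (B (u + L) - B u) ^+ 2 / (sigma * Num.sqrt A).
Proof.
move=> s0 r0 uv vu zm0 rmin0 rminmax dz dK dM dB rpos rhi kap0 ez1 ezr zu zv.
move=> jump q0 turn perim green A0 Ale I1ge jensen big.
have L0 : 0 < L by lra.
have uL : u <= u + L by lra.
have rmax0 : 0 < rmax by lra.
have pi0 : 0 < pi :> R := pi_gt0 R.
pose m := A^-1 * I1.
have mge : rmax / 32 <= m by rewrite /m ler_pdivlMl// mulrC.
have m0 : 0 < m by apply: lt_le_trans mge; rewrite divr_gt0.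
(* At the mean radius [m] the tangent bound collapses to [A / m ^ 2], which is at least [2 * pi] by
   [big]; so [delta] and then [lam] are nonnegative. *)
have I2ge : 2 * pi <= I2.
  apply: le_trans (jensen m m0).
  have -> : I1 = A * m by rewrite /m mulrA divff ?mul1r// gt_eqF.
  have -> : 3 / m ^+ 2 * A - 2 / m ^+ 3 * (A * m) = A / m ^+ 2 by field; rewrite gt_eqF.
  by rewrite ler_pdivlMr// exprn_gt0.
have lamL : 2 * sigma * (I2 - 2 * pi) <= lam * L.
  have : (2 * sigma * (K u + M u) + lam * u) <= (2 * sigma * (K (u + L) + M (u + L)) + lam * (u + L)).
    apply: (@ge0_deriv_le _ (fun s => 2 * sigma * (K s + M s) + lam * s)
      (fun s => 2 * sigma * (kap s + e * z1 s / r s) + lam * 1)) => // s _.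
    by rewrite mulr1 -jump mulr_ge0 ?sqr_ge0// ltW.
  have : 0 <= 2 * sigma * (2 * pi - (K (u + L) - K u)).
    by apply: mulr_ge0; lra.
  have : 0 <= 2 * sigma * (- (M (u + L) - M u) - I2).
    by apply: mulr_ge0; lra.
  lra.
have lam0 : 0 <= lam.
  rewrite -(pmulr_lge0 _ L0); apply: le_trans lamL.
  by apply: mulr_ge0; lra.
pose k := Num.sqrt ((2 * sigma / rmax + lam) / rho).
have k2 : k ^+ 2 = (2 * sigma / rmax + lam) / rho.
  rewrite sqr_sqrtr//; apply: divr_ge0; last exact: ltW.
  by apply: addr_ge0 => //; apply: divr_ge0; lra.
have k0 : 0 <= k by exact: sqrtr_ge0.
(* After squaring, with [a = n_r] in [[0, 1]], the curvature term is handled by [a ^ 2 <= a] and the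
   pressure term by [a ^ 2 <= 1] and [lam >= 0]. *)
have qk s : u < s < v -> k * (e * z1 s) <= - q s.
  move=> /ezr a0; have a1 := ez1 s.
  rewrite -(@ler_pXn2r _ 2)// ?nnegrE ?oppr_ge0//; last exact: mulr_ge0.
  rewrite sqrrN exprMn k2 mulrAC ler_pdivrMr// [leRHS]mulrC jump.
  set a := e * z1 s in a0 a1 *.
  have a2 : a ^+ 2 <= a by rewrite expr2 -[leRHS]mulr1 ler_wpM2l.
  have a3 : a ^+ 2 <= 1 by apply: le_trans a1.
  have h1 : lam * a ^+ 2 <= lam by rewrite -[leRHS]mulr1 ler_wpM2l.
  have h2 : a ^+ 2 / rmax <= a / r s.
    by apply: ler_pM => //; [exact: sqr_ge0|rewrite invr_ge0 ltW|rewrite lef_pV2 ?posrE].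
  have h3 : 2 * sigma * (a ^+ 2 / rmax) <= 2 * sigma * (kap s + a / r s).
    rewrite ler_wpM2l ?mulr_ge0 ?(ltW s0)//; have := kap0 s; lra.
  lra.
have B1 : k * (2 * zm) <= B v - B u.
  have -> : k * (2 * zm) = k * (e * z v) - k * (e * z u) by rewrite zu zv; ring.
  apply: (@deriv_le _ (fun s => k * (e * z s)) B (fun s => k * (e * z1 s)) (fun s => - q s)) => //.
  exact: ltW.
have B2 : B v <= B (u + L).
  apply: (@ge0_deriv_le _ B (fun s => - q s)) => // [|s _]; first exact: ltW.
  by rewrite oppr_ge0.
have B3 : k * (2 * zm) <= B (u + L) - B u by lra.
have kz0 : 0 <= k * (2 * zm) by apply: mulr_ge0 => //; lra.
apply: (@weber_lower_bound _ sigma rho _ A rmax (2 * zm) L lam) => //.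
- lra.
- lra.
- apply: (le_trans Ale); rewrite ler_wpM2l//; lra.
- apply: le_trans big; apply: ler_wpM2l; first lra.
  by rewrite ler_pXn2r ?nnegrE//; [lra|exact: ltW].
- apply: (le_trans perim); rewrite mulrC.
  have -> : rmax + 2 * zm / 2 = rmax + zm by field.
  by rewrite ler_wpM2r//; lra.
- have : (k * (2 * zm)) ^+ 2 <= (B (u + L) - B u) ^+ 2.
    by rewrite ler_pXn2r// ?nnegrE//; exact: le_trans B3.
  rewrite exprMn k2 => h.
  rewrite -ler_pdivrMl//; apply: le_trans h.
  by rewrite le_eqVlt; apply/orP; left; apply/eqP; field; rewrite !gt_eqF.
Qed.

Lemma periodic_deriv (R : realType) (f df : R -> R) (L : R) :
  (forall s : R, is_derive s 1 f (df s)) -> (forall s, f (s + L) = f s) ->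
  forall s, df (s + L) = df s.
Proof.
move=> hf pf s.
have ds : is_derive s 1 (fun y : R => y + L) 1.
  by apply: (is_derive_eq (is_deriv_add (is_derive_id s 1) (is_derive_cst L s 1))); rewrite addr0.
have d2 : is_derive s 1 f (df (s + L)).
  have -> : f = (fun y => f (y + L)) by apply/funext => y; rewrite pf.
  by rewrite -[df _]mulr1; apply: is_deriv_comp.
by rewrite -(@derive_val _ _ _ _ _ _ _ (hf s)) (@derive_val _ _ _ _ _ _ _ d2).
Qed.

Lemma continuous_sqrt (R : realType) (f : R -> R) :
  continuous f -> continuous (fun x => Num.sqrt (f x)).
Proof.
move=> cf x; apply: (@continuous_comp _ _ _ f (@Num.sqrt R)); first exact: cf.
exact: sqrt_continuous.
Qed.

(** * The boundary conditions along the curve *)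

Section bubble.
Context {R : realType} (sigma rho : R) (E : set (plane R)) (c : R -> plane R) (L : R).
Context (n : plane R -> plane R) (psi : plane R -> R^o) (W gamma lambda : R).
Hypothesis s0 : 0 < sigma.
Hypothesis r0 : 0 < rho.
Hypothesis cs : cross_section E c L.
Hypothesis on : outer_unit_normal E c n.
Hypothesis br : bubble_ring sigma rho E c n psi W gamma lambda.
Hypothesis sgn : forall p, boundary E p -> normal_derive n (Psi psi W) p <= 0.
Context (e u v rt zm rmin rmax : R).
Hypothesis n1 : forall s, (n (c s)).1 = e * (derive1 c s).2.
Hypothesis n2 : forall s, (n (c s)).2 = - e * (derive1 c s).1.
Hypothesis spec : arcs_spec E c L e u v rt zm rmin rmax.

Let kap s := curvature c n s.

Lemma curvature_expand s : kap s = e * ((derive1 c s).1 * (derive1 (derive1 c) s).2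
  - (derive1 c s).2 * (derive1 (derive1 c) s).1).
Proof.
have h (a b x y : R) : - (a * (e * y) + b * (- e * x)) = e * (x * b - y * a) by ring.
by rewrite -h -n1 -n2.
Qed.

Lemma continuous_curvature : continuous (kap : R -> R).
Proof.
have [_ _ cr1 cz1] := curve_continuous cs.
have [cr2 cz2] := curve_continuous2 cs.
rewrite (funext curvature_expand).
exact: (cts_mul (@cts_cst R e) (cts_sub (cts_mul cr1 cz2) (cts_mul cz1 cr2))).
Qed.

Lemma curve_fst_gt0 s : 0 < (c s).1.
Proof. exact: (cs_half_plane cs (@curve_closure _ _ _ _ cs s)). Qed.

Lemma continuous_normal_over_radius :
  continuous (fun s : R => e * (derive1 c s).2 / (c s).1 : R).
Proof.
have [cr _ _ cz1] := curve_continuous cs.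
have rn0 s : (c s).1 != 0 by rewrite gt_eqF// curve_fst_gt0.
exact: (cts_mul (cts_mul (@cts_cst R e) cz1) (cts_inv rn0 cr)).
Qed.

(** The base point [(rt, 0)] is interior, which makes the support function positive, and the line
    [r = rt] meets the curve only at the ends of the two arcs. *)
Lemma curve_turning (K : R -> R) : (forall s : R, is_derive s 1 K (kap s)) ->
  K (u + L) - K u <= 2 * pi /\ L <= (rmax + zm) * (K (u + L) - K u).
Proof.
have [[ee uv vu _] [rmin0 rminrt rtrmax _ _] [hx hz _ _ chord] [ru rv zu zv]
  [right_arc left_arc _ _ _]] := spec.
move=> dK.
have dr s := let: And4 h _ _ _ := curve_deriv cs s in h.
have dz s := let: And4 _ h _ _ := curve_deriv cs s in h.
have dr1 s := let: And4 _ _ h _ := curve_deriv cs s in h.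
have dz1 s := let: And4 _ _ _ h := curve_deriv cs s in h.
have pr s : (c (s + L)).1 = (c s).1 by rewrite (curve_periodic cs).
have pz s : (c (s + L)).2 = (c s).2 by rewrite (curve_periodic cs).
have pr1 := periodic_deriv dr pr.
have pz1 := periodic_deriv dz pz.
have D0 s : 0 < e * (((c s).1 - rt) * (derive1 c s).2 - (c s).2 * (derive1 c s).1).
  have p0 : E° (rt, 0).
    by apply: chord; rewrite normr0; have [[]] := spec.
  have := @normal_support_lt _ _ _ _ _ cs on s _ p0; rewrite n1 n2 /=; lra.
split.
  apply: (total_curvature_le dr dz dr1 dz1 (curve_unit cs) pr pz pr1 pz1 ee
    curvature_expand dK D0 uv vu).
  - by move=> s /right_arc h; rewrite subr_eq0 gt_eqF.
  - by move=> s /left_arc h; rewrite subr_eq0 lt_eqF.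
apply: (@perimeter_le _ _ _ _ _ _ _ _ _ e rt L u v dr dz dr1 dz1 (curve_unit cs)
  pr pz pr1 pz1 ee curvature_expand dK uv vu _ (curvature_ge0 cs on)) => s.
have [h1 h2] := hx _ (@curve_closure _ _ _ _ cs s).
apply: lerD; last exact: (hz _ (@curve_closure _ _ _ _ cs s)).
rewrite ler_norml; apply/andP; split; lra.
Qed.

Let q s := (c s).1^-1 * normal_derive n psi (c s) - W * dot (n (c s)) er.

Lemma dot_normal_er s : dot (n (c s)) er = e * (derive1 c s).2.
Proof. by rewrite /dot n1 /er /= mulr1 mulr0 addr0. Qed.

Lemma jump_condition s : rho * q s ^+ 2 =
  2 * sigma * (kap s + e * (derive1 c s).2 / (c s).1) + lambda.
Proof.
have := br_jump br s; rewrite /ring_curvature -/(kap s) -/(q s) dot_normal_er; lra.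
Qed.

Lemma relative_velocity_le0 s : q s <= 0.
Proof.
have [_ _ hext] := on s.
have Ap : (half_plane `\` E°) (c s).
  by split; [exact: curve_fst_gt0|have [_] := curve_boundary cs s].
have := normal_derive_Psi W (br_classical br) Ap hext.
have := sgn (curve_boundary cs s).
move: (normal_derive n (Psi psi W) (c s)) => X X0 XE.
have rpos := curve_fst_gt0 s.
suff -> : q s = (c s).1^-1 * X by rewrite pmulr_rle0 ?invr_gt0.
rewrite /q XE /dot /er /= mulr1 mulr0 addr0; field; by rewrite gt_eqF.
Qed.

(** The jump condition determines [q ^ 2] from the curvature, which is continuous for a C^2 curve,
    and [q <= 0] selects the root. *)
Lemma continuous_relative_velocity : continuous (q : R -> R).
Proof.
have qE s : q s = - Num.sqrt ((2 * sigma * (kap s + e * (derive1 c s).2 / (c s).1) + lambda) * rho^-1).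
  rewrite -jump_condition [rho * _]mulrC mulfK ?gt_eqF//.
  by rewrite sqrtr_sqr ler0_norm ?opprK// relative_velocity_le0.
rewrite (funext qE); apply: cts_opp; apply: continuous_sqrt.
exact: (cts_mul (cts_add (cts_mul (@cts_cst R _) (cts_add continuous_curvature
  continuous_normal_over_radius)) (@cts_cst R _)) (@cts_cst R _)).
Qed.

(** The integrands differ by [W * n_r = W * e * z'], whose integral over the closed curve vanishes;
    periodicity of [q] allows the period to start at [u]. *)
Lemma circulation_primitive (B : R -> R) : (forall s : R, is_derive s 1 B (- q s)) ->
  circulation c L n psi = B (u + L) - B u.
Proof.
move=> dB; have L0 := c2b_length (cs_C2 cs).
have per := curve_periodic cs.
have dz s := let: And4 _ h _ _ := curve_deriv cs s in h.
have pz s : (c (s + L)).2 = (c s).2 by rewrite per.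
have [_ cz _ cz1] := curve_continuous cs.
have pq s : - q (s + L) = - q s by rewrite /q per.
rewrite (periodic_primitive pq dB u 0) add0r /circulation /arc_integral.
have qE s : (c s).1^-1 * normal_derive n psi (c s) = q s + W * e * (derive1 c s).2.
  by rewrite /q dot_normal_er; ring.
rewrite (_ : (fun s => _) = (fun s => q s + W * e * (derive1 c s).2)); last exact/funext.
have cf := cts_add continuous_relative_velocity (cts_mul (@cts_cst R (W * e)) cz1).
have dF (s : R) : is_derive s 1 (fun s => - B s + W * e * (c s).2)
    (q s + W * e * (derive1 c s).2).
  by rewrite -[q s]opprK; exact: (is_deriv_add (is_deriv_opp (dB s))
    (is_deriv_scale (W * e) (dz s))).
rewrite (Rintegral_primitive L0 cf dF).
by have := pz 0; rewrite add0r => ->; ring.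
Qed.

Lemma weber_ge : 2 * pi * major_radius E ^+ 2 <= area E ->
  (256 * 128)^-1 * (1 + delta E) <= weber sigma rho E c L n psi.
Proof.
move=> big.
have [[_ uv vu zm0] [rmin0 rminrt rtrmax _ _] [hx _ _ _ _] [_ _ zu zv]
  [_ _ zr _ _]] := spec.
have [K dK] := primitive continuous_curvature.
have [M dM] := primitive continuous_normal_over_radius.
have [B dB] := primitive (cts_opp continuous_relative_velocity).
have [turn perim] := curve_turning dK.
rewrite /weber (circulation_primitive dB).
apply: (@ring_estimate R (fun s => (c s).1) (fun s => (c s).2)
  (fun s => (derive1 c s).2) kap q K M B e u v zm rmin rmax L sigma rho lambda
  (area E) (area_integral E (fun p => p.1)) (area_integral E (fun p => (p.1 ^+ 2)^-1))
  s0 r0 uv vu zm0 rmin0 _ _ dK dM dB) => //.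
- exact: lt_trans rtrmax.
- by move=> s; have [_ h _ _] := curve_deriv cs s.
- exact: curve_fst_gt0.
- by move=> s; have [] := hx _ (@curve_closure _ _ _ _ cs s).
- exact: (curvature_ge0 cs on).
- by move=> s; rewrite -n1; have [h _] := normal_norm_le on s; exact: le_trans (ler_norm _) h.
- exact: jump_condition.
- exact: relative_velocity_le0.
- exact: (area_integral_inv_sq_le cs spec dM).
- exact: (area_gt0 cs spec).
- exact: (area_le spec).
- exact: (first_moment_ge cs spec).
- by move=> m m0; exact: (inv_sq_moment_ge spec m0).
Qed.

End bubble.

Theorem corollary1 (R : realType) :
  exists C : R, 0 < C /\
  forall (sigma rho : R) (E : set (plane R)) (c : R -> plane R) (L : R)
    (n : plane R -> plane R) (psi : plane R -> R^o) (W gamma lambda : R),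
    0 < sigma -> 0 < rho ->
    cross_section E c L ->
    outer_unit_normal E c n ->
    bubble_ring sigma rho E c n psi W gamma lambda ->
    (forall p, boundary E p -> normal_derive n (Psi psi W) p <= 0) ->
    2 * pi * major_radius E ^+ 2 <= area E ->
    C * (1 + delta E) <= weber sigma rho E c L n psi.
Proof.
exists ((256 * 128)^-1); split; first by rewrite invr_gt0 mulr_gt0.
move=> sigma rho E c L n psi W gamma lambda s0 r0 cs on br sgn big.
have [e [u [v [rt [zm [rmin [rmax [n1 n2 spec]]]]]]]] := arcs cs on.
exact: (weber_ge s0 r0 cs on br sgn n1 n2 spec big).
Qed.
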